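(* In the setting described in the context, the smoothed function $\phi^{\mathrm{cd}}_\xi$ is smooth ($C^\infty$) on $\mathbb{R}^n$ for every $\xi>0$. Furthermore, let $\bar x$ be a point. (i) If $\phi^{\mathrm{cd}}$ is continuous at $\bar x$, then $\lim_{\xi\to0}\phi^{\mathrm{cd}}_\xi(\bar x)=\phi^{\mathrm{cd}}(\bar x)$. (ii) If $\phi^{\mathrm{cd}}$ is differentiable at $\bar x$, then $\lim_{\xi\to0}\nabla_x\phi^{\mathrm{cd}}_\xi(\bar x)=\nabla_x\phi^{\mathrm{cd}}(\bar x)$, and thus, for every $\beta>0$, $$\lim_{\xi\to0}\frac{\bar x-\mathrm{proj}_{\mathcal{X}}\big(\bar x-\beta\nabla_x\phi^{\mathrm{cd}}_\xi(\bar x)\big)}{\beta}=\frac{\bar x-\mathrm{proj}_{\mathcal{X}}\big(\bar x-\beta\nabla_x\phi^{\mathrm{cd}}(\bar x)\big)}{\beta},$$ where $\mathrm{proj}_{\mathcal{X}}$ is the Euclidean projection onto $\mathcal{X}$.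
   Context: Data: $\mathcal{X}\subseteq\mathbb{R}^n$, real-valued functions $f(x,y)$ and $g(x,y)$ for $x\in\mathcal{X}$, $y\in\mathbb{R}^m$, and a fixed initial point $y_0$. Regularity assumptions: (1) $f$ is continuous and $g$ is twice continuously differentiable on $\mathcal{X}\times\mathbb{R}^m$; (2) $\mathcal{X}$ is convex and compact; (3) $g$ is Lipschitz smooth (has Lipschitz gradient) with constant $\overline L_g$ on $\mathcal{X}\times\mathbb{R}^m$; (4) $\nabla^2_{yy}g$ is Lipschitz continuous with constant $\overline{\overline L}_g$ on $\mathcal{X}\times\mathbb{R}^m$; (5) $g\ge\underline g$ on $\mathcal{X}\times\mathbb{R}^m$; (6) for every $x\in\mathcal{X}$ the sublevel set $\{y:g(x,y)\le g(x,y_0)\}$ is compact and contained in a compact set $\mathcal{Y}\subset\mathbb{R}^m$ independent of $x$; (7) $f$ is Lipschitz continuous with constant $L_f$ on $\{(x,y):x\in\mathcal{X},\ g(x,y)\le g(x,y_0)\}$. Let $\overline f$ be a constant with $|f(x,y)|\le\overline f$ whenever $x\in\mathcal{X}$ and $g(x,y)\le g(x,y_0)$. Lower-level method: $\mathcal{M}$ is an iterative optimization method with step size schedule $\boldsymbol\eta$; for each $x\in\mathcal{X}$, applied to $g(x,\cdot)$ from $y_0$ it generates a sequence $\{y_k\}$. Let $\hat S(x)$ be the set of accumulation points of this sequence. Standing assumptions: every point of $\hat S(x)$ is a stationary point of $g(x,\cdot)$; there is an integer $K_0$ such that for all $x\in\mathcal{X}$ and $k\ge K_0$, $g(x,y_k)\le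 g(x,y_0)$. Define $y^{\mathrm{cd}}(x)\in\arg\min_{y\in\hat S(x)}f(x,y)$ and the correspondence-driven hyperfunction $\phi^{\mathrm{cd}}(x):=f(x,y^{\mathrm{cd}}(x))$ for $x\in\mathcal{X}$, extended by $\phi^{\mathrm{cd}}(x):=\overline f$ for $x\notin\mathcal{X}$. Let $\widetilde{\mathcal{X}}:=\{x\in\mathcal{X}:g(x,\cdot)\text{ is not Morse}\}$, where $g(x,\cdot)$ is Morse if all its stationary points have nonsingular Hessian $\nabla^2_{yy}g$. Standing assumptions: $\widetilde{\mathcal{X}}$ has Lebesgue measure zero, and the set of points of $\mathcal{X}\setminus\widetilde{\mathcal{X}}$ at which $y^{\mathrm{cd}}$ is discontinuous has Lebesgue measure zero. Smoothing: for $\xi>0$, $h_\xi(z)=\frac{1}{(2\pi\xi^2)^{n/2}}\exp\big(-\frac{\|z\|^2}{2\xi^2}\big)$ and $\phi^{\mathrm{cd}}_\xi(x):=\int_{\mathbb{R}^n}h_\xi(x-z)\phi^{\mathrm{cd}}(z)\,dz$. *)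

(* Defs.v *)
From HB Require Import structures.
From mathcomp Require Import all_boot all_order all_algebra.
From mathcomp Require Import all_classical all_reals all_analysis.

Set Implicit Arguments.
Unset Strict Implicit.
Unset Printing Implicit Defensive.

Import Order.TTheory GRing.Theory Num.Theory.
Import numFieldNormedType.Exports.

Local Open Scope classical_set_scope.
Local Open Scope ring_scope.

(* The canonical norm of 'rV[R]_d in the library is the sup norm. It induces
   the Euclidean topology and the same notion of differentiability, so
   [continuous], [compact], [differentiable], etc. are the library's; wherever
   the value of the norm matters, the Euclidean norm below is used. *)
Definition enorm {R : realType} {d : nat} (v : 'rV[R]_d) : R :=
  Num.sqrt (\sum_i v ord0 i ^+ 2).

(* Spectral norm, with matrices acting on row vectors. *)
Definition opnorm {R : realType} {d : nat} (A : 'M[R]_d) : R :=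
  sup [set enorm (v *m A) | v in [set v : 'rV[R]_d | enorm v <= 1]].

Definition lipschitz_wrt {R : realType} {d : nat} {W : zmodType}
    (nrm : W -> R) (L : R) (A : set 'rV[R]_d) (h : 'rV[R]_d -> W) : Prop :=
  forall u v, A u -> A v -> nrm (h u - h v) <= L * enorm (u - v).

Definition partial {R : realType} {d : nat} (i : 'I_d) (h : 'rV[R]_d -> R)
    : 'rV[R]_d -> R :=
  fun x => 'D_(delta_mx ord0 i) h x.

Definition grad {R : realType} {d : nat} (h : 'rV[R]_d -> R) (x : 'rV[R]_d)
    : 'rV[R]_d :=
  \row_i partial i h x.

Definition hessian {R : realType} {d : nat} (h : 'rV[R]_d -> R)
    (x : 'rV[R]_d) : 'M[R]_d :=
  \matrix_(i, j) partial j (partial i h) x.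

(* C^k regularity on a set U, meant for U open. *)
Fixpoint Ck_on {R : realType} {d : nat} (k : nat) (U : set 'rV[R]_d)
    (h : 'rV[R]_d -> R) : Prop :=
  match k with
  | 0%N => forall x, U x -> {for x, continuous h}
  | k'.+1 => (forall x, U x -> differentiable h x) /\
             (forall i, Ck_on k' U (partial i h))
  end.

Definition smooth {R : realType} {d : nat} (h : 'rV[R]_d -> R) : Prop :=
  forall k, Ck_on k setT h.

Definition joint {R : realType} {n m : nat} {T : Type}
    (h : 'rV[R]_n -> 'rV[R]_m -> T) : 'rV[R]_(n + m) -> T :=
  fun w => h (lsubmx w) (rsubmx w).

Definition stationary {R : realType} {d : nat} (h : 'rV[R]_d -> R)
    (y : 'rV[R]_d) : Prop :=
  grad h y = 0.

Definition morse {R : realType} {d : nat} (h : 'rV[R]_d -> R) : Prop :=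
  forall y, stationary h y -> hessian h y \in unitmx.

(* Euclidean projection; it is the unique nearest point when X is nonempty,
   closed and convex. *)
Definition euclidean_proj {R : realType} {d : nat} (X : set 'rV[R]_d)
    (v : 'rV[R]_d) : 'rV[R]_d :=
  get [set p | X p /\ forall q, X q -> enorm (v - p) <= enorm (v - q)].

(* Lebesgue measure on R^d: the d-fold product of the one-dimensional (Borel)
   Lebesgue measure, built on d-tuples by recursion on d, and then completed. *)

Section cons_measure.
Context {R : realType} {d : nat}.
Let RR := measurableTypeR R.
Variable mu : {sigma_finite_measure set (d.-tuple RR) -> \bar R}.

Definition tcons (p : RR * d.-tuple RR) : d.+1.-tuple RR :=
  [tuple of p.1 :: p.2].

Lemma measurable_tcons : measurable_fun setT tcons.
Proof.
by apply: measurable_cons; [exact: measurable_fst|exact: measurable_snd].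
Qed.

Lemma preimage_tcons_measurable (A : set (d.+1.-tuple RR)) :
  measurable A -> measurable (tcons @^-1` A).
Proof. by move=> mA; rewrite -[X in measurable X]setTI; exact: measurable_tcons. Qed.

Definition cons_measure (A : set (d.+1.-tuple RR)) : \bar R :=
  ((@lebesgue_measure R) \x mu)%E (tcons @^-1` A).

Let cons_measure0 : cons_measure set0 = 0%E.
Proof. by rewrite /cons_measure preimage_set0 measure0. Qed.

Let cons_measure_ge0 A : (0 <= cons_measure A)%E.
Proof. exact: measure_ge0. Qed.

Let cons_measure_sigma_additive : semi_sigma_additive cons_measure.
Proof.
move=> F mF tF mUF; rewrite /cons_measure preimage_bigcup.
apply: measure_semi_sigma_additive.
- by move=> n; exact: preimage_tcons_measurable.
- apply/trivIsetP => /= i j _ _ ij; rewrite -preimage_setI.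
  by move/trivIsetP : tF => /(_ _ _ _ _ ij) ->//; rewrite preimage_set0.
- by rewrite -preimage_bigcup; exact: preimage_tcons_measurable.
Qed.

HB.instance Definition _ := isMeasure.Build _ _ _ cons_measure
  cons_measure0 cons_measure_ge0 cons_measure_sigma_additive.

Let cons_measure_sigma_finite : sigma_finite setT cons_measure.
Proof.
have /sigma_finiteP[F [TF ndF Foo]] := sigma_finiteT (@lebesgue_measure R).
have /sigma_finiteP[G [TG ndG Goo]] := sigma_finiteT mu.
pose g (t : d.+1.-tuple RR) : RR * d.-tuple RR := (thead t, [tuple of behead t]).
have gK : cancel tcons g.
  by move=> [a t]; rewrite /g theadE; congr pair; apply: val_inj.
have Kg : cancel g tcons by move=> t; rewrite /tcons/= -tuple_eta.
have mg : measurable_fun setT g.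
  apply/measurable_fun_pairP; split => /=.
    exact: measurable_tnth.
  exact: measurable_behead.
exists (fun k => g @^-1` (F k `*` G k)).
  rewrite -preimage_bigcup (_ : \bigcup_k _ = setT) ?preimage_setT//.
  rewrite -setXTT TF TG predeqE => -[x y]; split.
    by move=> [k _ []/= ? ?]; split; exists k.
  move=> [/= [k _ Fkx] [l _ Gly]]; exists (maxn k l) => //; split.
  - by move: x Fkx; exact/subsetPset/ndF/leq_maxl.
  - by move: y Gly; exact/subsetPset/ndG/leq_maxr.
move=> k; have [mFk Fkoo] := Foo k; have [mGk Gkoo] := Goo k; split.
  by rewrite -[X in measurable X]setTI; apply: mg => //; exact: measurableX.
rewrite /cons_measure -comp_preimage (_ : g \o tcons = id); last exact/funext.
by rewrite preimage_id product_measure1E// lte_mul_pinfty// ge0_fin_numE.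
Qed.

HB.instance Definition _ := @Measure_isSigmaFinite.Build _ _ _ cons_measure
  cons_measure_sigma_finite.

End cons_measure.

Fixpoint lebesgue_tuple (R : realType) (d : nat) :
    {sigma_finite_measure set (d.-tuple (measurableTypeR R)) -> \bar R} :=
  match d with
  | 0%N => \d_([tuple] : 0.-tuple (measurableTypeR R))
  | d'.+1 => cons_measure (lebesgue_tuple R d')
  end.

Definition lebesgueRd (R : realType) (d : nat) :=
  @completed_measure_extension _ _ R (lebesgue_tuple R d).
Arguments lebesgueRd : clear implicits.

HB.instance Definition _ (R : realType) (d : nat) :=
  Measure.on (lebesgueRd R d).

Definition vec {R : realType} {d : nat} (t : d.-tuple (measurableTypeR R))
    : 'rV[R]_d :=
  \row_i tnth t i.

Definition lebesgue_null {R : realType} {d : nat} (A : set 'rV[R]_d) : Prop :=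
  (lebesgueRd R d).-negligible (vec @^-1` A).

Definition gaussian {R : realType} {d : nat} (xi : R) (z : 'rV[R]_d) : R :=
  ((2 * pi * xi ^+ 2) `^ (d%:R / 2))^-1 *
  expR (- (enorm z ^+ 2 / (2 * xi ^+ 2))).

Definition smoothing {R : realType} {d : nat} (xi : R) (phi : 'rV[R]_d -> R)
    (x : 'rV[R]_d) : R :=
  \int[lebesgueRd R d]_z (gaussian xi (x - vec z) * phi (vec z)).

(* A pair (x, y) is represented by row_mx x y; this is X x R^m. *)
Definition cylinder {R : realType} {n m : nat} (X : set 'rV[R]_n)
    : set 'rV[R]_(n + m) :=
  [set w | X (lsubmx w)].

Definition sublevel {R : realType} {n m : nat} (g : 'rV[R]_n -> 'rV[R]_m -> R)
    (y0 : 'rV[R]_m) (x : 'rV[R]_n) : set 'rV[R]_m :=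
  [set y | g x y <= g x y0].

(* A method maps a step size schedule, an objective and an initial point to the
   sequence of iterates. *)
Definition method (R : realType) (m : nat) : Type :=
  (nat -> R) -> ('rV[R]_m -> R) -> 'rV[R]_m -> nat -> 'rV[R]_m.

Definition iterates {R : realType} {n m : nat} (M : method R m)
    (eta : nat -> R) (g : 'rV[R]_n -> 'rV[R]_m -> R) (y0 : 'rV[R]_m)
    (x : 'rV[R]_n) : nat -> 'rV[R]_m :=
  M eta (g x) y0.

Definition Shat {R : realType} {n m : nat} (M : method R m) (eta : nat -> R)
    (g : 'rV[R]_n -> 'rV[R]_m -> R) (y0 : 'rV[R]_m) (x : 'rV[R]_n)
    : set 'rV[R]_m :=
  cluster (iterates M eta g y0 x @ \oo).

Definition non_morse {R : realType} {n m : nat} (X : set 'rV[R]_n)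
    (g : 'rV[R]_n -> 'rV[R]_m -> R) : set 'rV[R]_n :=
  [set x | X x /\ ~ morse (g x)].

(* Correspondence-driven hyperfunction, extended by the constant fbar off X. *)
Definition phi_cd {R : realType} {n m : nat} (X : set 'rV[R]_n)
    (f : 'rV[R]_n -> 'rV[R]_m -> R) (ycd : 'rV[R]_n -> 'rV[R]_m) (fbar : R)
    (x : 'rV[R]_n) : R :=
  if x \in X then f x (ycd x) else fbar.

(* Main.v *)
Require Import Defs.
From HB Require Import structures.
From mathcomp Require Import all_boot all_order all_algebra.
From mathcomp Require Import all_classical all_reals all_analysis measurable_realfun.
From mathcomp Require Import ring lra.
Set Implicit Arguments.
Unset Strict Implicit.
Unset Printing Implicit Defensive.
Import Order.TTheory GRing.Theory Num.Theory.
Import numFieldNormedType.Exports.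
Local Open Scope classical_set_scope.
Local Open Scope ring_scope.

(** The hyperfunction [phi] is bounded, since every accumulation point of the
    iterates stays in the closed sublevel set on which [f] is bounded, and it
    is measurable for the completed Lebesgue measure, since relative to the
    closed set [X] it is continuous off a null set
    ([ae_continuous_vmeasurable]). Boundedness and measurability already give
    smoothness; the two limits use in addition only the local behaviour of
    [phi] at the point.

    All of Gaussian analysis is reduced to the single identity that a Gaussian
    density has integral one. Write [S P] for [smoothing xi P], with [P] in the
    class [tame] of measurable functions growing more slowly than every
    [exp (e * |z|^2)]. This class is closed under sums and products, contains
    polynomials and bounded measurable functions, and is integrable against
    every Gaussian, because a narrow Gaussian times [exp (e * |z|^2)] is
    dominated by a wider one ([integrable_smoothing]).

    A second-order expansion of the Gaussian kernel, with a tame remainder,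
    gives Frechet differentiability without any theorem on differentiation
    under the integral sign, and the formula
      [d_i (S P) (x) = xi^-2 * S ((z_i - x_i) P) (x)]
    ([smoothing_differentiable]). Since [z_i P] is tame again, induction yields
    smoothness ([smoothing_smooth]). Read backwards, the same formula computes
    moments: starting from [S 1 = 1], differentiating in the centre of the
    Gaussian produces the first, second and fourth moments without evaluating
    any integral.

    The limits then follow from pointwise bounds. If [phi] is continuous at
    [x], then [|phi z - phi x| <= e + C |z - x|^2] for all [z], and the second
    moment is [xi^2] per coordinate. If [phi] is differentiable at [x], its
    first-order remainder is at most [e |z - x| + C |z - x|^3]; multiplied by
    [z_i - x_i] and divided by [xi^2], it contributes at most a multiple of
    [e + C xi^2] to the gradient, by the second and fourth moments, while the
    affine part contributes exactly the gradient of [phi]. The polynomial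
    terms replace any truncation of the integral and any change of variables.
    Finally the projected step converges because the projection onto a convex
    compact set is nonexpansive. *)

(** * The Gaussian density on the completed Lebesgue measure *)

(** The carrier with the completed sigma-algebra. It is convertible to the type of
    tuples; the separate name selects the sigma-algebra when a measurability
    statement is elaborated. *)
Definition completedRd (R : realType) (d : nat) :=
  caratheodory_type ((lebesgue_tuple R d)^*)%mu.

Lemma measurable_completed (R : realType) d
    (A : set (d.-tuple (measurableTypeR R))) :
  measurable A -> measurable (A : set (completedRd R d)).
Proof. exact: caratheodory_measurable_mu_ext. Qed.

Lemma measurable_fun_completed (R : realType) d (T : measurableType d)
    k (f : k.-tuple (measurableTypeR R) -> T) :
  measurable_fun setT f ->
  measurable_fun setT (f : completedRd R k -> T).
Proof.
by move=> mf _ A mA; apply: measurable_completed; exact: mf.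
Qed.

(** The identity map is measurable from the completed to the Borel sigma-algebra
    and pushes the completed measure forward to the original one, so that Borel
    integrands can be integrated by Tonelli's theorem. *)
Lemma ge0_integral_completed (R : realType) d
    (f : d.-tuple (measurableTypeR R) -> \bar R) :
  measurable_fun setT f -> (forall t, 0 <= f t)%E ->
  (\int[lebesgueRd R d]_t (f : completedRd R d -> \bar R) t =
   \int[lebesgue_tuple R d]_t f t)%E.
Proof.
move=> mf f0.
pose idc (t : completedRd R d) : d.-tuple (measurableTypeR R) := t.
have mid : measurable_fun setT idc.
  by move=> _ A mA; rewrite setTI; exact: measurable_completed.
rewrite -[LHS](@ge0_integral_pushforward _ _ _ _ _ idc mid _ setT f)//.
apply: eq_measure_integral => A mA _.
exact: (@measurable_mu_extE _ _ _ (lebesgue_tuple R d) A mA).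
Qed.

Section gaussian_integral.
Context {R : realType}.
Implicit Types xi : R.

Lemma measurable_prod_normal_pdf d xi (c : 'I_d -> R) :
  measurable_fun setT (fun t : d.-tuple (measurableTypeR R) =>
    \prod_i normal_pdf (c i) xi (tnth t i)).
Proof.
apply: (@measurable_prod _ _ _ _ _ _
  (fun i (t : d.-tuple (measurableTypeR R)) => normal_pdf (c i) xi (tnth t i))).
move=> i _; apply: (measurableT_comp (measurable_normal_pdf _ _)).
exact: measurable_tnth.
Qed.

(** By induction on the dimension, a product of one-dimensional normal densities
    being integrated one coordinate at a time by Tonelli's theorem. *)
Lemma integral_prod_normal_pdf d xi (c : 'I_d -> R) :
  (\int[lebesgue_tuple R d]_t (\prod_i normal_pdf (c i) xi (tnth t i))%:E = 1)%E.
Proof.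
elim: d c => [|d IHd] c.
  rewrite /= (eq_integral (cst 1%E)); last by move=> t _; rewrite big_ord0.
  by rewrite integral_cst// mul1e; exact: diracT.
pose F (t : d.+1.-tuple (measurableTypeR R)) : \bar R :=
  (\prod_i normal_pdf (c i) xi (tnth t i))%:E.
have mF : measurable_fun setT F.
  by apply/measurable_EFinP; exact: measurable_prod_normal_pdf.
have F0 t : (0 <= F t)%E.
  by rewrite lee_fin prodr_ge0// => i _; exact: normal_pdf_ge0.
have -> : (\int[lebesgue_tuple R d.+1]_t F t =
    \int[(@lebesgue_measure R \x lebesgue_tuple R d)%E]_p (F (tcons p)))%E.
  have := @ge0_integral_pushforward _ _ _ _ _ _ (@measurable_tcons R d)
    ((@lebesgue_measure R) \x lebesgue_tuple R d)%E setT F measurableT mF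
    (fun t _ => F0 t).
  rewrite preimage_setT => <-; apply: eq_measure_integral => [|//].
  exact: measurable_tcons.
rewrite fubini_tonelli1//=; last first.
  exact: (measurableT_comp mF (@measurable_tcons R d)).
rewrite /fubini_F -[RHS](integral_normal_pdf (c ord0) xi).
apply: eq_integral => x _.
have FE t : F (tcons (x, t)) = ((normal_pdf (c ord0) xi x)%:E *
    (\prod_i normal_pdf (c (lift ord0 i)) xi (tnth t i))%:E)%E.
  rewrite /F big_ord_recl EFinM /= (tnth0 x t); congr (_ * (_)%:E)%E.
  by apply: eq_bigr => i _; rewrite (tnthS x t).
under eq_integral do rewrite FE.
rewrite ge0_integralZl//=; last 3 first.
- by apply/measurable_EFinP; exact: measurable_prod_normal_pdf.
- by move=> t _; rewrite lee_fin prodr_ge0// => i _; exact: normal_pdf_ge0.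
- by rewrite lee_fin; exact: normal_pdf_ge0.
by rewrite IHd mule1.
Qed.

Lemma enorm_sqr d (v : 'rV[R]_d) : enorm v ^+ 2 = \sum_i v ord0 i ^+ 2.
Proof. by rewrite sqr_sqrtr// sumr_ge0// => i _; exact: sqr_ge0. Qed.

Lemma gaussian_prod d xi (x : 'rV[R]_d) (t : d.-tuple (measurableTypeR R)) :
  0 < xi ->
  gaussian xi (x - vec t) = \prod_i normal_pdf (x ord0 i) xi (tnth t i).
Proof.
move=> xi0; rewrite /gaussian enorm_sqr.
under eq_bigr do rewrite normal_pdfE ?gt_eqF//.
rewrite big_split /= prodr_const card_ord; congr (_ * _).
  rewrite [d%:R / 2]mulrC powRrM powR12_sqrt; last first.
    by apply: mulr_ge0; rewrite ?sqr_ge0// mulr_ge0 ?pi_ge0.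
  rewrite powR_mulrn ?sqrtr_ge0// /normal_peak exprVn; congr (_ ^-1).
  by congr (Num.sqrt _ ^+ _); rewrite mulr2n; ring.
rewrite /normal_fun -expR_sum; congr expR.
rewrite mulr_suml -sumrN; apply: eq_bigr => i _.
by rewrite !mxE mulNr -[xi ^+ 2 *+ 2]mulr_natl; congr (- (_ / _)); ring.
Qed.

Lemma integral_gaussian d xi (x : 'rV[R]_d) : 0 < xi ->
  (\int[lebesgueRd R d]_t (gaussian xi (x - vec t))%:E = 1)%E.
Proof.
move=> xi0; rewrite -[RHS](integral_prod_normal_pdf xi (x ord0)).
have mg : measurable_fun setT (fun t : d.-tuple (measurableTypeR R) =>
    (\prod_i normal_pdf (x ord0 i) xi (tnth t i))%:E).
  by apply/measurable_EFinP; exact: measurable_prod_normal_pdf.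
rewrite -ge0_integral_completed//; last first.
  by move=> t; rewrite lee_fin prodr_ge0// => i _; exact: normal_pdf_ge0.
by apply: eq_integral => t _; rewrite gaussian_prod.
Qed.
End gaussian_integral.

(** * Coordinates of row vectors *)

Section coordinates.
Context {R : realType}.

Lemma coord_le_norm d (v : 'rV[R]_d) i : `|v ord0 i| <= `|v|.
Proof.
rewrite [leRHS]/Num.norm /= mx_normrE; apply/bigmax_geP; right => /=.
by exists (ord0, i).
Qed.

Lemma norm_le_coord d (v : 'rV[R]_d) c : 0 <= c ->
  (forall i, `|v ord0 i| <= c) -> `|v| <= c.
Proof.
move=> c0 vc; rewrite [leLHS]/Num.norm /= mx_normrE; apply/bigmax_leP; split => //.
by move=> [i j] _ /=; rewrite ord1.
Qed.

Lemma norm_coord_eq d (v : 'rV[R]_d) : v != 0 -> exists i, `|v| = `|v ord0 i|.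
Proof.
move=> v0; have [|[i j] e] := @mx_norm_neq0 _ _ _ v; last first.
  by exists j; rewrite [LHS]e /= [i]ord1.
by move: v0; rewrite -(normr_eq0 v).
Qed.

Lemma bigcup_countType_measurable d (T : measurableType d) (I : countType)
    (P : set I) (F : I -> set T) :
  (forall i, P i -> measurable (F i)) -> measurable (\bigcup_(i in P) F i).
Proof.
move=> mF; rewrite bigcup_mkcond; apply: countable_bigcupT_measurable => // i.
by case: ifPn => // /set_mem; exact: mF.
Qed.

(** An open set is the union of the rational boxes that it contains, which are
    countably many, and a box is a finite intersection of coordinate slabs. *)
Lemma open_vec_measurable d (O : set 'rV[R]_d) : open O ->
  measurable (vec @^-1` O : set (d.-tuple (measurableTypeR R))).
Proof.
move=> oO.
pose box (qk : d.-tuple rat * nat) : set 'rV[R]_d :=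
  [set y | forall i, `|y ord0 i - ratr (tnth qk.1 i)| < qk.2.+1%:R^-1].
have -> : O = \bigcup_(qk in [set qk | box qk `<=` O]) box qk.
  apply/seteqP; split => [x Ox|x [qk sub bx]]; last exact: sub.
  have /nbhs_ballP[e /= e0 xeO] := oO x Ox.
  have [k kltx] : exists k : nat, k.+1%:R^-1 < e / 2.
    have := near_infty_natSinv_lt (PosNum (divr_gt0 e0 (ltr0Sn R 1))).
    by case=> k _ /(_ k (leqnn k)); exists k.
  have k0 : 0 < k.+1%:R^-1 :> R by rewrite invr_gt0.
  have /choice[q qP] : forall i : 'I_d, exists q : rat,
      `|x ord0 i - ratr q| < k.+1%:R^-1.
    move=> i.
    have [|q] := @rat_in_itvoo R (x ord0 i - k.+1%:R^-1) (x ord0 i + k.+1%:R^-1).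
      by rewrite ltrBlDr -addrA ltrDl addr_gt0.
    by rewrite in_itv/= => ?; exists q; rewrite ltr_distlC.
  exists ([tuple q i | i < d], k); last by move=> i /=; rewrite tnth_mktuple.
  move=> y /= yb; apply: xeO; split => // i j; rewrite ord1.
  have := yb j; rewrite tnth_mktuple => yj.
  rewrite -ball_normE /=.
  apply: le_lt_trans (ler_distD (ratr (q j)) _ _) _.
  rewrite [e]splitr ltrD// (lt_trans _ kltx)//; last by rewrite distrC.
rewrite preimage_bigcup; apply: bigcup_countType_measurable => -[q k] _.
rewrite (_ : _ @^-1` _ = \bigcap_(i in [set: 'I_d])
    (fun t => tnth t i) @^-1` ball (ratr (tnth q i) : R) k.+1%:R^-1); last first.
  apply/seteqP; split => t /= H i.
    by move=> _; have := H i; rewrite /= mxE -ball_normE /= distrC.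
  by have := H i Logic.I; rewrite /= mxE -ball_normE /= distrC.
apply: fin_bigcap_measurable => [|i _]; first exact: finite_finset.
rewrite -[X in measurable X]setTI.
by apply: measurable_tnth => //; exact: measurable_ball.
Qed.
End coordinates.

(** * Measurability and domination *)

Section abstract_space.
Context d (T : measurableType d) (R : realType).

Lemma measurable_fun_const_off (A : set T) (f : T -> R) (c : R) :
  measurable A -> measurable_fun A f -> (forall t, ~ A t -> f t = c) ->
  measurable_fun setT f.
Proof.
move=> mA mf fc; rewrite -(setUv A); apply/measurable_funU => //.
  exact: measurableC.
split=> //; apply: (eq_measurable_fun (cst c)) => [t|]; last exact: measurable_cst.
by rewrite inE /= => At; rewrite fc.
Qed.

Lemma measurable_fun_expR_sum (I : Type) (s : seq I) (k : R) (x : I -> R)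
    (f : I -> T -> R) :
  (forall i, measurable_fun setT (f i)) ->
  measurable_fun setT (fun t => expR (k * \sum_(i <- s) `|x i - f i t|)).
Proof.
move=> mf; apply: measurableT_comp => //; apply: measurable_funM => //.
apply: measurable_sum => i; apply: measurableT_comp => //.
exact: measurable_funB.
Qed.

Lemma integrable_le_norm (mu : {measure set T -> \bar R}) (f g : T -> R) :
  measurable_fun setT f -> mu.-integrable setT (EFin \o g) ->
  (forall t, `|f t| <= g t) -> mu.-integrable setT (EFin \o f).
Proof.
move=> mf ig fg; apply: le_integrable ig => //; first exact/measurable_EFinP.
by move=> t _ /=; rewrite lee_fin (le_trans (fg t))// ler_norm.
Qed.

Lemma integrableZ_EFin (mu : {measure set T -> \bar R}) (f : T -> R) k :
  mu.-integrable setT (EFin \o f) ->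
  mu.-integrable setT (EFin \o (fun t => k * f t)).
Proof. by move=> /(integrableZl measurableT k); under eq_fun do rewrite -EFinM. Qed.

Lemma integrableB_EFin (mu : {measure set T -> \bar R}) (f g : T -> R) :
  mu.-integrable setT (EFin \o f) -> mu.-integrable setT (EFin \o g) ->
  mu.-integrable setT (EFin \o (fun t => f t - g t)).
Proof. by move=> iF iG; have := integrableB measurableT iF iG. Qed.

Lemma le_norm_Rintegral (mu : {measure set T -> \bar R}) (f g : T -> R) :
  mu.-integrable setT (EFin \o f) -> mu.-integrable setT (EFin \o g) ->
  (forall t, `|f t| <= g t) ->
  `|\int[mu]_t f t| <= \int[mu]_t g t.
Proof.
move=> iF iG fg; apply: le_trans (le_normr_Rintegral measurableT iF) _.
apply: le_Rintegral => //; exact: (integrable_abse iF).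
Qed.

End abstract_space.

Section vmeasurable.
Context {R : realType}.

Definition vmeasurable d (P : 'rV[R]_d -> R) : Prop :=
  measurable_fun [set: completedRd R d] (fun t : completedRd R d => P (vec t)).

(** On [X] the preimage of an open [U] is a relatively open set, up to a subset
    of the null set where continuity fails; completeness of the measure makes
    that subset measurable. *)
Lemma ae_continuous_vmeasurable d (X N : set 'rV[R]_d) (c : R)
    (P : 'rV[R]_d -> R) :
  closed X -> lebesgue_null N ->
  (forall x, X x -> ~ N x -> P @ within X (nbhs x) --> P x) ->
  (forall x, ~ X x -> P x = c) ->
  vmeasurable P.
Proof.
move=> cX N0 cP Pc.
have mX : measurable (vec @^-1` X : set (completedRd R d)).
  rewrite -[X]setCK preimage_setC; apply: measurableC.
  exact: measurable_completed (open_vec_measurable (closed_openC cX)).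
apply: (measurable_fun_const_off mX) => [|t Xt]; last exact: Pc.
apply: (measurability _ (RGenOpens.measurableE R)) => _ [_ [a [b ->]] <-].
set U := `]a, b[%classic; have oU : open U by exact: interval_open.
pose O := interior (~` X `|` P @^-1` U).
rewrite (_ : _ `&` _ = (vec @^-1` X `&` vec @^-1` O) `|`
    (vec @^-1` (X `&` N `&` P @^-1` U `\` O) : set (completedRd R d))).
  apply: measurableU.
    apply: measurableI => //.
    exact: measurable_completed (open_vec_measurable (@open_interior _ _)).
  apply: measure_is_complete_caratheodory.
  by apply: negligibleS N0 => t [[[]]].
apply/seteqP; split => t /=.
  move=> [Xt Ut]; have [Ot|nOt] := pselect (O (vec t)); [by left|right; split => //].
  split=> //; split => //; apply: contrapT => nN; apply: nOt.
  have /= := cP _ Xt nN U; rewrite /O /interior.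
  have nU : nbhs (P (vec t)) U by exact: open_nbhs_nbhs.
  move=> /(_ nU) H.
  apply: (filterS _ (H : nbhs (vec t) (fun y => X y -> U (P y)))) => y Py.
  by have [Xy|] := pselect (X y); [right; exact: Py|left].
by move=> [[Xt /interior_subset[]//]|[[[]]]].
Qed.

Lemma vmeasurable_coord d (i : 'I_d) : vmeasurable (fun z => z ord0 i).
Proof.
rewrite /vmeasurable.
under eq_fun do rewrite mxE.
apply: (@measurable_fun_completed _ _ _ d (fun t => tnth t i)); exact: measurable_tnth.
Qed.

Lemma gaussian_measurable d (xi : R) (x : 'rV[R]_d) : 0 < xi ->
  measurable_fun [set: completedRd R d]
    (fun t : completedRd R d => gaussian xi (x - vec t)).
Proof.
move=> xi0; under eq_fun do rewrite gaussian_prod//.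
apply: (@measurable_fun_completed _ _ _ d
  (fun t => \prod_i normal_pdf (x ord0 i) xi (tnth t i))).
exact: measurable_prod_normal_pdf.
Qed.

Lemma gaussian_ge0 d (xi : R) (x : 'rV[R]_d) : 0 <= gaussian xi x.
Proof. by rewrite mulr_ge0 ?expR_ge0// invr_ge0 powR_ge0. Qed.

Lemma integrable_gaussian d (xi : R) (x : 'rV[R]_d) : 0 < xi ->
  (lebesgueRd R d).-integrable setT
    (EFin \o (fun t : completedRd R d => gaussian xi (x - vec t))).
Proof.
move=> xi0; apply/integrableP; split.
  by apply/measurable_EFinP; exact: gaussian_measurable.
rewrite (eq_integral (fun t : completedRd R d => (gaussian xi (x - vec t))%:E)).
  by rewrite integral_gaussian// ltry.
by move=> t _ /=; rewrite ger0_norm// gaussian_ge0.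
Qed.

Definition sqn d (z : 'rV[R]_d) : R := \sum_i z ord0 i ^+ 2.

(** Growth below every [exp (e * |z|^2)], rather than at most exponential growth:
    this class contains everything that appears in the expansions below, and
    its stability under products is just the splitting of [e] into two halves. *)
Definition tame d (P : 'rV[R]_d -> R) : Prop :=
  vmeasurable P /\
  forall e, 0 < e -> exists C, forall z, `|P z| <= C * expR (e * sqn z).

Lemma sqn_ge0 d (z : 'rV[R]_d) : 0 <= sqn z.
Proof. by apply: sumr_ge0 => i _; exact: sqr_ge0. Qed.

Lemma sqn_coord d (z : 'rV[R]_d) i : z ord0 i ^+ 2 <= sqn z.
Proof. by rewrite /sqn (bigD1 i)//= lerDl sumr_ge0// => j _; exact: sqr_ge0. Qed.

Lemma sqn_le_shift d (x z : 'rV[R]_d) : sqn z <= 2 * sqn x + 2 * sqn (x - z).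
Proof.
rewrite /sqn !mulr_sumr -big_split/=; apply: ler_sum => i _; rewrite !mxE.
set a := x _ _; set b := z _ _.
have := sqr_ge0 (2 * a - b); nra.
Qed.

Lemma tame_bounded d (P : 'rV[R]_d -> R) B :
  vmeasurable P -> (forall z, `|P z| <= B) -> tame P.
Proof.
move=> mP PB; split=> // e e0; exists B => z; apply: le_trans (PB z) _.
rewrite ler_peMr//; first exact: le_trans (PB z).
by rewrite -expR0 ler_expR mulr_ge0// ?sqn_ge0// ltW.
Qed.

Lemma tame_cst d (c : R) : tame (fun _ : 'rV[R]_d => c).
Proof. by apply: (@tame_bounded _ _ `|c|) => //; exact: measurable_cst. Qed.

Lemma tame_coord d (i : 'I_d) : tame (fun z : 'rV[R]_d => z ord0 i).
Proof.
split=> [|e e0]; first exact: vmeasurable_coord.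
exists (1 + e^-1) => z; set u := z ord0 i.
have h1 : `|u| <= 1 + u ^+ 2.
  by rewrite ler_norml; apply/andP; split; nra.
apply: le_trans h1 _.
apply: (@le_trans _ _ ((1 + e^-1) * (1 + e * u ^+ 2))); last first.
  rewrite ler_wpM2l ?addr_ge0 ?invr_ge0 ?(ltW e0)//.
  apply: le_trans (expR_ge1Dx _) _; rewrite ler_expR ler_wpM2l ?(ltW e0)//.
  exact: sqn_coord.
have -> : (1 + e^-1) * (1 + e * u ^+ 2) = 1 + u ^+ 2 + e^-1 + e * u ^+ 2.
  by field; rewrite gt_eqF.
have e10 : 0 <= e^-1 by rewrite invr_ge0 ltW.
have eu0 : 0 <= e * u ^+ 2 by rewrite mulr_ge0 ?sqr_ge0 ?ltW.
lra.
Qed.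

Lemma tame_norm d (P : 'rV[R]_d -> R) : tame P -> tame (fun z => `|P z|).
Proof.
move=> [mP hP]; split; first exact: measurableT_comp.
by move=> e /hP[C HC]; exists C => z; rewrite normr_id.
Qed.

Lemma tameM d (P Q : 'rV[R]_d -> R) :
  tame P -> tame Q -> tame (fun z => P z * Q z).
Proof.
move=> [mP hP] [mQ hQ]; split; first exact: measurable_funM.
move=> e e0; have e20 : 0 < e / 2 by rewrite divr_gt0.
have [C HC] := hP _ e20; have [D HD] := hQ _ e20.
exists (C * D) => z; rewrite normrM (_ : e * _ = e / 2 * sqn z + e / 2 * sqn z).
  by rewrite expRD mulrACA ler_pM.
by rewrite -mulrDl -splitr.
Qed.

Lemma tameD d (P Q : 'rV[R]_d -> R) :
  tame P -> tame Q -> tame (fun z => P z + Q z).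
Proof.
move=> [mP hP] [mQ hQ]; split; first exact: measurable_funD.
move=> e e0; have [C HC] := hP _ e0; have [D HD] := hQ _ e0.
by exists (C + D) => z; rewrite mulrDl (le_trans (ler_normD _ _))// lerD.
Qed.

Lemma tameZ d (c : R) (P : 'rV[R]_d -> R) : tame P -> tame (fun z => c * P z).
Proof. by apply: tameM; exact: tame_cst. Qed.

Lemma tameB d (P Q : 'rV[R]_d -> R) :
  tame P -> tame Q -> tame (fun z => P z - Q z).
Proof.
move=> tP tQ; apply: tameD => //.
by under eq_fun do rewrite -mulN1r; exact: tameZ.
Qed.

Lemma tameX d (P : 'rV[R]_d -> R) k : tame P -> tame (fun z => P z ^+ k).
Proof.
move=> tP; elim: k => [|k IHk]; first exact: tame_cst.
by under eq_fun do rewrite exprS; exact: tameM.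
Qed.

Lemma tame_sum d (I : Type) (s : seq I) (F : I -> 'rV[R]_d -> R) :
  (forall i, tame (F i)) -> tame (fun z => \sum_(i <- s) F i z).
Proof.
move=> tF; elim: s => [|i s IHs].
  by under eq_fun do rewrite big_nil; exact: tame_cst.
by under eq_fun do rewrite big_cons; exact: tameD.
Qed.

(** Completing the square gives [s * |z_i| <= s^2 / e + e * z_i^2], the source of
    the constant. *)
Lemma tame_expR_dist d (x : 'rV[R]_d) (s : R) : 0 <= s ->
  tame (fun z => expR (s * \sum_i `|x ord0 i - z ord0 i|)).
Proof.
move=> s0; split.
  by apply: measurable_fun_expR_sum => i; exact: vmeasurable_coord.
move=> e e0; exists (expR (\sum_i (s * `|x ord0 i| + s ^+ 2 / e))) => z.
rewrite ger0_norm ?expR_ge0// -expRD ler_expR mulr_sumr /sqn mulr_sumr -big_split/=.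
apply: ler_sum => i _.
apply: (@le_trans _ _ (s * `|x ord0 i| + s * `|z ord0 i|)).
  by rewrite -mulrDr ler_wpM2l// ler_normB.
rewrite -addrA lerD2l -(real_normK (num_real (z ord0 i))).
set u := `|_|.
have : 0 <= e * (u - s / e) ^+ 2 by rewrite mulr_ge0 ?sqr_ge0 ?ltW.
have -> : e * (u - s / e) ^+ 2 = e * u ^+ 2 - 2 * (s * u) + s ^+ 2 / e.
  by field; rewrite gt_eqF.
have : 0 <= s * u by rewrite mulr_ge0 ?normr_ge0.
lra.
Qed.

(** Since [|z|^2 <= 2 |x|^2 + 2 |x - z|^2], choosing [e = 1 / (8 xi^2)] leaves a
    kernel [exp (- |x - z|^2 / (4 xi^2))], which the Gaussian of width [2 xi]
    dominates up to a constant. *)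
Lemma integrable_smoothing d (xi : R) (x : 'rV[R]_d) (P : 'rV[R]_d -> R) :
  0 < xi -> tame P ->
  (lebesgueRd R d).-integrable setT
    (EFin \o (fun t : completedRd R d => gaussian xi (x - vec t) * P (vec t))).
Proof.
move=> xi0 [mP hP].
have xi2 : 0 < xi ^+ 2 by rewrite exprn_gt0.
have [C HC] := hP ((8 * xi ^+ 2)^-1) ltac:(by rewrite invr_gt0 mulr_gt0).
have C0 : 0 <= C by have := le_trans (normr_ge0 _) (HC 0); rewrite pmulr_lge0// expR_gt0.
pose c k := ((2 * pi * k ^+ 2) `^ (d%:R / 2))^-1 : R.
have c0 k : 0 <= c k by rewrite invr_ge0 powR_ge0.
have c1 : 0 < c (2 * xi).
  by rewrite invr_gt0 powR_gt0// mulr_gt0 ?mulr_gt0 ?pi_gt0// exprn_gt0// mulr_gt0.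
(* The ratio of the normalizations, times the cost of recentring at [x]. *)
pose K := c xi * C * expR (sqn x / (4 * xi ^+ 2)) / c (2 * xi).
have K0 : 0 <= K by rewrite divr_ge0 ?(ltW c1)// !mulr_ge0 ?expR_ge0.
apply: (integrable_le_norm _ (integrableZ_EFin K
  (integrable_gaussian x (mulr_gt0 (ltr0Sn R 1) xi0)))).
  exact: (measurable_funM (gaussian_measurable x xi0) mP).
move=> t; rewrite normrM [`|gaussian _ _|]ger0_norm ?gaussian_ge0//.
set z := vec t; apply: le_trans (ler_wpM2l (gaussian_ge0 _ _) (HC z)) _.
rewrite /gaussian -/(c xi) -/(c (2 * xi)) !enorm_sqr -/(sqn (x - z)).
have -> : K * (c (2 * xi) * expR (- (sqn (x - z) / (2 * (2 * xi) ^+ 2)))) =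
   c xi * C * (expR (sqn x / (4 * xi ^+ 2)) * expR (- (sqn (x - z) / (2 * (2 * xi) ^+ 2)))).
  by rewrite /K; field; rewrite gt_eqF.
rewrite mulrACA ler_wpM2l ?mulr_ge0// -!expRD ler_expR.
have : (8 * xi ^+ 2)^-1 * sqn z <= (8 * xi ^+ 2)^-1 * (2 * sqn x + 2 * sqn (x - z)).
  by rewrite ler_wpM2l ?sqn_le_shift// invr_ge0 mulr_ge0// ltW.
have := sqn_ge0 (x - z).
have -> : (8 * xi ^+ 2)^-1 = xi ^- 2 / 8 by field; rewrite gt_eqF.
have -> : sqn (x - z) / (2 * xi ^+ 2) = xi ^- 2 * sqn (x - z) / 2 by field; rewrite gt_eqF.
have -> : sqn (x - z) / (2 * (2 * xi) ^+ 2) = xi ^- 2 * sqn (x - z) / 8 by field; rewrite gt_eqF.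
have -> : sqn x / (4 * xi ^+ 2) = xi ^- 2 * sqn x / 4 by field; rewrite gt_eqF.
move=> D0; have : 0 <= xi ^- 2 * sqn (x - z) by rewrite mulr_ge0// invr_ge0 ltW.
nra.
Qed.

End vmeasurable.

(** * Linearity and monotonicity of the smoothing operator *)

Section smoothing_algebra.
Context {R : realType}.
Variables (d : nat) (xi : R).
Hypothesis xi0 : 0 < xi.
Implicit Types (P Q : 'rV[R]_d -> R) (x : 'rV[R]_d).

Lemma smoothingD P Q x : tame P -> tame Q ->
  smoothing xi (fun z => P z + Q z) x = smoothing xi P x + smoothing xi Q x.
Proof.
move=> tP tQ; rewrite /smoothing -RintegralD//; try exact: integrable_smoothing.
by apply: eq_Rintegral => t _; rewrite mulrDr.
Qed.

Lemma smoothingZ c P x : tame P ->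
  smoothing xi (fun z => c * P z) x = c * smoothing xi P x.
Proof.
move=> tP; rewrite /smoothing -RintegralZl//; try exact: integrable_smoothing.
by apply: eq_Rintegral => t _; rewrite mulrCA.
Qed.

Lemma smoothingB P Q x : tame P -> tame Q ->
  smoothing xi (fun z => P z - Q z) x = smoothing xi P x - smoothing xi Q x.
Proof.
move=> tP tQ; rewrite /smoothing -RintegralB//; try exact: integrable_smoothing.
by apply: eq_Rintegral => t _; rewrite mulrBr.
Qed.

(** The normalization of the Gaussian, from which all moments are derived below by
    differentiation. *)
Lemma smoothing_cst c x : smoothing xi (fun=> c) x = c.
Proof.
rewrite (_ : (fun=> c) = (fun _ : 'rV[R]_d => c * 1)); last first.
  by apply/funext => z; rewrite mulr1.
rewrite smoothingZ; last exact: tame_cst.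
rewrite -[RHS]mulr1; congr (_ * _).
rewrite /smoothing /Rintegral; under eq_integral do rewrite mulr1.
by rewrite integral_gaussian.
Qed.

Lemma smoothing_sum (I : Type) (s : seq I) (F : I -> 'rV[R]_d -> R) x :
  (forall i, tame (F i)) ->
  smoothing xi (fun z => \sum_(i <- s) F i z) x = \sum_(i <- s) smoothing xi (F i) x.
Proof.
move=> tF; elim: s => [|i s IHs].
  by under eq_fun do rewrite big_nil; rewrite big_nil smoothing_cst.
under eq_fun do rewrite big_cons.
by rewrite big_cons smoothingD// ?IHs//; exact: tame_sum.
Qed.

Lemma le_norm_smoothing P Q x : tame P -> tame Q -> (forall z, `|P z| <= Q z) ->
  `|smoothing xi P x| <= smoothing xi Q x.
Proof.
move=> tP tQ PQ; apply: le_norm_Rintegral; try exact: integrable_smoothing.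
by move=> t; rewrite normrM ger0_norm ?gaussian_ge0// ler_wpM2l// gaussian_ge0.
Qed.
End smoothing_algebra.

(** * Differentiability of the smoothed function *)

Section frechet.
Context {R : realType}.

(** Remainders of smooth kernels are quadratic, which turns differentiability into
    one explicit inequality, stable under integration. *)
Lemma differentiable_quadratic d (F : 'rV[R]_d -> R) x (l : 'I_d -> R) K :
  (forall h, `|h| <= 1 ->
     `|F (h + x) - (F x + \sum_i h ord0 i * l i)| <= K * `|h| ^+ 2) ->
  differentiable F x /\ forall i, partial i F x = l i.
Proof.
move=> FK.
pose df (h : 'rV[R]_d) : R := \sum_i h ord0 i * l i.
have ldf : linear df.
  move=> k u v; rewrite /df /GRing.scale/= mulr_sumr -big_split/=.
  by apply: eq_bigr => i _; rewrite !mxE mulrDl mulrA.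
pose dfL := GRing.isLinear.Build R 'rV[R]_d R _ df ldf.
pose df' : {linear 'rV[R]_d -> R} := HB.pack df dfL.
have cdf : continuous df'.
  apply: continuous_big => [|i _ u]; first exact: add_continuous.
  apply: (@continuousM R 'rV[R]_d (fun h => h ord0 i) (cst (l i)) u).
    exact: coord_continuous.
  exact: cst_continuous.
have dF : F \o shift x = cst (F x) + df' +o_ (0 : 'rV[R]_d) id.
  apply/eqaddoP => _/posnumP[e].
  have K1 : 0 < `|K| + 1 by rewrite ltr_wpDl.
  have N1 := @nbhs0_le R 'rV[R]_d 1 ltr01.
  have eK : 0 < e%:num / (`|K| + 1) by rewrite divr_gt0.
  have N2 := @nbhs0_le R 'rV[R]_d _ eK.
  suff N : \forall h \near (0 : 'rV[R]_d),
      `|F (h + x) - (F x + df h)| <= e%:num * `|h| by exact: N.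
  apply: (filterS _ (filterI N1 N2)) => h [h1] /=.
  rewrite ler_pdivlMr// mulrC => h2; apply: le_trans (FK h h1) _.
  rewrite expr2 mulrA ler_wpM2r// (le_trans _ h2)// ler_wpM2r//.
  by rewrite (le_trans (ler_norm K))// lerDl.
have dFE := diff_unique cdf dF.
have diffF : differentiable F x.
  apply/diff_locallyP; rewrite dFE; split => //.
split=> // i.
rewrite /partial deriveE// dFE -[LHS]/(df _) /df (bigD1 i)//= mxE !eqxx mul1r big1 ?addr0//.
by move=> j ji; rewrite mxE (negbTE ji) andbF mul0r.
Qed.

(** Both signs of [t] follow from [expR t - (1 + t) <= t * (expR t - 1)], which is
    the inequality [1 - t <= expR (- t)] multiplied by [expR t]. *)
Lemma expR_sub1D_le (t : R) : `|expR t - (1 + t)| <= t ^+ 2 * expR `|t|.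
Proof.
rewrite ger0_norm ?subr_ge0 ?expR_ge1Dx//.
have h : expR t - (1 + t) <= t * (expR t - 1).
  have := expR_ge1Dx (- t); have := expRxMexpNx_1 t; have := expR_gt0 t.
  nra.
apply: le_trans h _.
have [t0|t0] := leP 0 t.
  have := expR_ge1Dx (- t); have := expRxMexpNx_1 t; have := expR_gt0 t.
  move=> e0 e1 e2; rewrite expr2 -mulrA ler_wpM2l// ger0_norm//; nra.
have : 1 <= expR (- t) by rewrite -expR0 ler_expR oppr_ge0 ltW.
have := expR_ge1Dx t.
move=> e1 e2; apply: (@le_trans _ _ (t ^+ 2)); first nra.
by rewrite ler_peMr ?sqr_ge0// ltr0_norm.
Qed.

Lemma sqr_le_expR (u : R) : 0 <= u -> u ^+ 2 <= 4 * expR u.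
Proof.
move=> u0; rewrite [u in expR u]splitr expRD -expr2.
have h : (1 + u / 2) ^+ 2 <= expR (u / 2) ^+ 2.
  by rewrite lerXn2r ?nnegrE ?expR_ge0 ?expR_ge1Dx// addr_ge0 ?divr_ge0.
nra.
Qed.
End frechet.

Section smoothing_derivative.
Context {R : realType}.
Variables (d : nat) (xi : R).
Hypothesis xi0 : 0 < xi.
Implicit Types (P Q : 'rV[R]_d -> R) (x : 'rV[R]_d).

Let xi2 : 0 < xi ^+ 2. Proof. by rewrite exprn_gt0. Qed.
Let a : R := xi ^- 2.
Let a0 : 0 < a. Proof. by rewrite invr_gt0. Qed.

Lemma gaussian_shift (w h : 'rV[R]_d) :
  gaussian xi (w + h) =
  gaussian xi w * expR (- (a * (\sum_i h ord0 i * w ord0 i + sqn h / 2))).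
Proof.
rewrite /gaussian !enorm_sqr -[RHS]mulrA -expRD; congr (_ * expR _).
rewrite -!/(sqn _).
have -> : sqn (w + h) = sqn w + 2 * (\sum_i h ord0 i * w ord0 i) + sqn h.
  rewrite /sqn mulr_sumr -!big_split/=; apply: eq_bigr => i _; rewrite !mxE; ring.
by rewrite /a; field; rewrite gt_eqF.
Qed.

(** Taylor expansion of the exponential factor in [gaussian_shift]. The exponent
    [t] satisfies [|t| <= |h| * u] with [u = a * (d + sum_i |w_i|)], so the
    remainder [t^2 * exp |t|] is at most [|h|^2 * 4 * exp (2 * u)]; the term
    [a * d] pays for the quadratic part of the exponent. What matters is that
    the bound is [|h|^2] times a tame function of [w]. *)
Lemma gaussian_shift_le (w h : 'rV[R]_d) : `|h| <= 1 ->
  `|gaussian xi (w + h) - gaussian xi w * (1 - a * \sum_i h ord0 i * w ord0 i)|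
  <= `|h| ^+ 2 * (gaussian xi w *
       (4 * expR (2 * (a * d%:R) + 2 * a * \sum_i `|w ord0 i|) + a * d%:R)).
Proof.
move=> h1; rewrite gaussian_shift -mulrBr normrM ger0_norm ?gaussian_ge0//.
rewrite [leRHS]mulrCA ler_wpM2l ?gaussian_ge0//.
set s := \sum_i h ord0 i * w ord0 i; set l := \sum_i `|w ord0 i|.
have l0 : 0 <= l by rewrite sumr_ge0.
have sl : `|s| <= `|h| * l.
  rewrite mulr_sumr; apply: le_trans (ler_norm_sum _ _ _) _.
  by apply: ler_sum => i _; rewrite normrM ler_wpM2r// coord_le_norm.
have qd : sqn h <= d%:R * `|h| ^+ 2.
  rewrite -[d in d%:R]card_ord mulr_natl -sumr_const; apply: ler_sum => i _.
  by rewrite -(real_normK (num_real _)) lerXn2r ?nnegrE ?coord_le_norm.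
have q0 := sqn_ge0 h; have n0 := normr_ge0 h.
have d0 : 0 <= d%:R :> R by rewrite ler0n.
set t := - (a * _); set u := a * (d%:R + l).
have u0 : 0 <= u by rewrite mulr_ge0 ?addr_ge0 ?(ltW a0).
have hh : `|h| ^+ 2 <= `|h| by rewrite expr2 ler_piMr.
have tu : `|t| <= `|h| * u.
  rewrite /t /u normrN normrM gtr0_norm// mulrCA ler_wpM2l ?(ltW a0)//.
  apply: le_trans (ler_normD _ _) _; rewrite [`|sqn h / 2|]ger0_norm ?divr_ge0//.
  rewrite mulrDr addrC lerD//.
  apply: (@le_trans _ _ (d%:R * `|h| ^+ 2)); first lra.
  by rewrite mulrC ler_wpM2r.
have tu' : `|t| <= u by rewrite (le_trans tu)// ler_piMl.
have -> : expR t - (1 - a * s) = (expR t - (1 + t)) - a * (sqn h / 2).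
  by rewrite /t; ring.
apply: le_trans (ler_normB _ _) _; rewrite mulrDr lerD//; last first.
  rewrite ger0_norm ?mulr_ge0 ?divr_ge0 ?(ltW a0)//.
  rewrite [leRHS]mulrCA ler_wpM2l ?(ltW a0)// mulrC; lra.
apply: le_trans (expR_sub1D_le t) _.
apply: (@le_trans _ _ (`|h| ^+ 2 * u ^+ 2 * expR u)).
  rewrite ler_pM ?sqr_ge0 ?expR_ge0 ?ler_expR//.
  by rewrite -(real_normK (num_real t)) -exprMn lerXn2r ?nnegrE// mulr_ge0.
rewrite -mulrA ler_wpM2l ?sqr_ge0//.
apply: le_trans (ler_wpM2r (expR_ge0 _) (sqr_le_expR u0)) _.
rewrite -[leLHS]mulrA -expRD ler_wpM2l// ler_expR /u; lra.
Qed.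

(** The first-order expansion of the kernel may be integrated term by term,
    because its remainder is bounded by [|h|^2] times a tame integrand. *)
Lemma smoothing_differentiable P x : tame P ->
  differentiable (smoothing xi P) x /\
  forall i, partial i (smoothing xi P) x =
    a * smoothing xi (fun z => (z ord0 i - x ord0 i) * P z) x.
Proof.
move=> tP.
have tw i : tame (fun z => (z ord0 i - x ord0 i) * P z).
  by apply: tameM => //; apply: tameB; [exact: tame_coord|exact: tame_cst].
pose Q (z : 'rV[R]_d) := (4 * expR (2 * (a * d%:R) +
  2 * a * \sum_i `|x ord0 i - z ord0 i|) + a * d%:R) * `|P z|.
have tQ : tame Q.
  apply: tameM; last exact: tame_norm.
  apply: tameD; last exact: tame_cst.
  apply: tameZ; under eq_fun do rewrite expRD.
  by apply: tameZ; apply: tame_expR_dist; rewrite mulr_ge0 ?ltW.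
apply: (@differentiable_quadratic _ _ _ _ _ (smoothing xi Q x)) => h h1.
(* [L] integrates to the first-order expansion of [smoothing xi P] at [x]. *)
pose L z := P z + \sum_i (h ord0 i * a) * ((z ord0 i - x ord0 i) * P z).
have tL : tame L.
  by apply: tameD => //; apply: tame_sum => i; exact: tameZ.
rewrite [X in _ - X](_ : _ = smoothing xi L x); last first.
  rewrite smoothingD//; last by apply: tame_sum => i; exact: tameZ.
  congr (_ + _); rewrite smoothing_sum//; last by move=> i; exact: tameZ.
  by apply: eq_bigr => i _; rewrite smoothingZ// mulrA.
rewrite /smoothing -RintegralB//; try exact: integrable_smoothing.
rewrite mulrC -RintegralZl//; last exact: integrable_smoothing.
apply: le_norm_Rintegral.
- by apply: integrableB_EFin; exact: integrable_smoothing.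
- by apply: integrableZ_EFin; exact: integrable_smoothing.
move=> t; set z := vec t.
have -> : h + x - z = (x - z) + h by rewrite -addrA addrC.
have -> : L z = P z * (1 - a * \sum_i h ord0 i * (x - z) ord0 i).
  rewrite /L mulrBr mulr1; congr (_ + _).
  rewrite mulr_sumr mulr_sumr -sumrN; apply: eq_bigr => i _; rewrite !mxE; ring.
rewrite mulrCA [_ * P z]mulrC -mulrBr normrM mulrC.
apply: le_trans (ler_wpM2r (normr_ge0 _) (gaussian_shift_le _ h1)) _.
under eq_bigr do rewrite mxE [(- z) _ _]mxE.
by rewrite /Q; set g := gaussian _ _; rewrite -!mulrA.
Qed.
End smoothing_derivative.

(** * Smoothness and Gaussian moments *)

Section Ck_algebra.
Context {R : realType} {d : nat}.
Implicit Types (f g : 'rV[R]_d -> R) (x : 'rV[R]_d).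

Lemma partialD f g i x : differentiable f x -> differentiable g x ->
  partial i (fun y => f y + g y) x = partial i f x + partial i g x.
Proof. by move=> df dg; rewrite /partial deriveD//; exact: diff_derivable. Qed.

Lemma partialM f g i x : differentiable f x -> differentiable g x ->
  partial i (fun y => f y * g y) x = partial i f x * g x + f x * partial i g x.
Proof.
move=> df dg; rewrite /partial (@deriveM _ _ f g); try exact: diff_derivable.
by rewrite /GRing.scale/= addrC mulrC [in X in X + _]mulrC mulrC.
Qed.

Lemma partial_cst c i : partial i (fun _ : 'rV[R]_d => c) = fun=> 0.
Proof. by apply/funext => x; exact: derive_cst. Qed.

Lemma partial_coord i j x : partial i (fun y => y ord0 j) x = (i == j)%:R.
Proof.
have [|_ ->//] := @differentiable_quadratic _ _ (fun y : 'rV[R]_d => y ord0 j) x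
  (fun i => (i == j)%:R) 0.
move=> h _; rewrite mul0r (bigD1 j)//= eqxx mulr1 big1 => [|k /negPf ->].
  by rewrite addr0 mxE [x _ _ + _]addrC subrr normr0.
by rewrite mulr0.
Qed.

Lemma Ck_onW k f : Ck_on k.+1 setT f -> Ck_on k setT f.
Proof.
elim: k f => [|k IHk] f [df pf].
  by move=> x _; apply: differentiable_continuous; exact: df.
by split => // i; apply: IHk; exact: pf.
Qed.

Lemma Ck_on_cst k c : Ck_on k setT (fun _ : 'rV[R]_d => c).
Proof.
elim: k c => [|k IHk] c; first by move=> x _; exact: cst_continuous.
by split => [x _|i]; [exact: differentiable_cst|rewrite partial_cst; exact: IHk].
Qed.

Lemma Ck_on_coord k j : Ck_on k setT (fun x : 'rV[R]_d => x ord0 j).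
Proof.
case: k => [|k]; first by move=> x _; exact: coord_continuous.
split => [x _|i]; first exact: differentiable_coord.
rewrite (_ : partial i _ = fun=> (i == j)%:R); first exact: Ck_on_cst.
by apply/funext => x; exact: partial_coord.
Qed.

Lemma Ck_onD k f g : Ck_on k setT f -> Ck_on k setT g ->
  Ck_on k setT (fun x => f x + g x).
Proof.
elim: k f g => [|k IHk] f g.
  by move=> cf cg x _; apply: continuousD; [exact: cf|exact: cg].
move=> [df pf] [dg pg]; split => [x _|i].
  exact: (differentiableD (df x I) (dg x I)).
rewrite (_ : partial i _ = fun x => partial i f x + partial i g x).
  exact: (IHk _ _ (pf i) (pg i)).
by apply/funext => x; rewrite partialD//; [exact: df|exact: dg].
Qed.

Lemma Ck_onM k f g : Ck_on k setT f -> Ck_on k setT g ->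
  Ck_on k setT (fun x => f x * g x).
Proof.
elim: k f g => [|k IHk] f g.
  by move=> cf cg x _; apply: continuousM; [exact: cf|exact: cg].
move=> Cf Cg; have [df pf] := Cf; have [dg pg] := Cg.
split => [x _|i]; first exact: (differentiableM (df x I) (dg x I)).
rewrite (_ : partial i _ = fun x => partial i f x * g x + f x * partial i g x).
  by apply: Ck_onD; [exact: (IHk _ _ (pf i) (Ck_onW Cg))|
                     exact: (IHk _ _ (Ck_onW Cf) (pg i))].
by apply/funext => x; rewrite partialM//; [exact: df|exact: dg].
Qed.
End Ck_algebra.

Section smoothing_smooth.
Context {R : realType}.
Variables (d : nat) (xi : R).
Hypothesis xi0 : 0 < xi.
Implicit Types (P : 'rV[R]_d -> R) (x : 'rV[R]_d).

(** The derivative formula solved for the integral: multiplying the integrand by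
    [z_i - c] costs one differentiation in the centre [x]. This is the recursion
    that produces all moments from [smoothing_cst]. *)
Lemma smoothing_coord_shift P x i c : tame P ->
  smoothing xi (fun z => (z ord0 i - c) * P z) x =
  (x ord0 i - c) * smoothing xi P x + xi ^+ 2 * partial i (smoothing xi P) x.
Proof.
move=> tP; have [_ ->] := smoothing_differentiable xi0 x tP.
rewrite mulrA mulfV ?mul1r ?gt_eqF ?exprn_gt0// -smoothingZ// -smoothingD//.
- by congr (smoothing xi _ x); apply/funext => z; ring.
- exact: tameZ.
- by apply: tameM => //; apply: tameB; [exact: tame_coord|exact: tame_cst].
Qed.

(** The derivative of [S P] is a combination, with polynomial coefficients, of
    [S P] and [S (z_i P)], both of which are covered by the induction hypothesis
    as it ranges over all tame functions. *)
Lemma smoothing_smooth P : tame P -> smooth (smoothing xi P).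
Proof.
move=> tP k; elim: k P tP => [|k IHk] P tP.
  move=> x _; apply: differentiable_continuous.
  by have [] := smoothing_differentiable xi0 x tP.
split=> [x _|i]; first by have [] := smoothing_differentiable xi0 x tP.
have tzP : tame (fun z => z ord0 i * P z) by apply: tameM => //; exact: tame_coord.
rewrite (_ : partial i _ = fun x => xi ^- 2 *
    (smoothing xi (fun z => z ord0 i * P z) x + (-1) * (x ord0 i * smoothing xi P x))).
  apply: Ck_onM; first exact: Ck_on_cst.
  apply: Ck_onD; first exact: IHk.
  apply: Ck_onM; first exact: Ck_on_cst.
  by apply: Ck_onM; [exact: Ck_on_coord|exact: IHk].
apply/funext => x.
have -> : (fun z : 'rV[R]_d => z ord0 i * P z) = (fun z => (z ord0 i - 0) * P z).
  by apply/funext => z; rewrite subr0.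
rewrite smoothing_coord_shift// subr0 mulN1r [_ + xi ^+ 2 * _]addrC addrK.
by rewrite mulrA mulVf ?mul1r// gt_eqF ?exprn_gt0.
Qed.

Lemma smoothing_first_moment j c :
  smoothing xi (fun z : 'rV[R]_d => z ord0 j - c) = fun x => x ord0 j - c.
Proof.
apply/funext => x; have := @smoothing_coord_shift _ x j c (tame_cst d 1).
under eq_fun do rewrite mulr1; move=> ->.
rewrite smoothing_cst// mulr1 (_ : smoothing xi _ = fun=> 1).
  by rewrite partial_cst mulr0 addr0.
by apply/funext => y; rewrite smoothing_cst.
Qed.

Lemma smoothing_second_moment i j b c x :
  smoothing xi (fun z : 'rV[R]_d => (z ord0 i - b) * (z ord0 j - c)) x =
  (x ord0 i - b) * (x ord0 j - c) + xi ^+ 2 * (i == j)%:R.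
Proof.
rewrite smoothing_coord_shift; last by apply: tameB; [exact: tame_coord|exact: tame_cst].
rewrite smoothing_first_moment; congr (_ + _ * _).
rewrite partialD; [|exact: differentiable_coord|exact: differentiable_cst].
by rewrite partial_cst addr0 partial_coord.
Qed.

(** In terms of [u = x_j - c], the recursion gives [u^2 + xi^2] and
    [u^3 + 3 xi^2 u] for the moments of order two and three, and then
    [xi^2 * (3 u^2 + 3 xi^2)] plus a multiple of [u] for order four, which is
    evaluated at [u = 0]. *)
Lemma smoothing_fourth_moment j x :
  smoothing xi (fun z : 'rV[R]_d => (z ord0 j - x ord0 j) ^+ 4) x = 3 * xi ^+ 4.
Proof.
set c := x ord0 j.
have tu k : tame (fun z : 'rV[R]_d => (z ord0 j - c) ^+ k).
  by apply: tameX; apply: tameB; [exact: tame_coord|exact: tame_cst].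
pose u (y : 'rV[R]_d) := y ord0 j - c.
have du y : differentiable u y.
  by apply: differentiableD; [exact: differentiable_coord|exact: differentiable_cst].
have pu y : partial j u y = 1.
  rewrite partialD; [|exact: differentiable_coord|exact: differentiable_cst].
  by rewrite partial_cst addr0 partial_coord eqxx.
have pu2 y : partial j (fun y => u y * u y) y = 2 * u y.
  by rewrite partialM// pu; ring.
have m2 : smoothing xi (fun z : 'rV[R]_d => (z ord0 j - c) ^+ 2) =
    fun y => u y * u y + xi ^+ 2.
  by apply/funext => y; rewrite smoothing_second_moment eqxx mulr1.
have m3 : smoothing xi (fun z : 'rV[R]_d => (z ord0 j - c) ^+ 3) =
    fun y => u y * (u y * u y + 3 * xi ^+ 2).
  apply/funext => y; under eq_fun do rewrite exprS.
  rewrite smoothing_coord_shift// m2 partialD//; last exact: differentiableM.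
  rewrite partial_cst addr0 pu2; rewrite -/(u y); ring.
under eq_fun do rewrite exprS.
rewrite smoothing_coord_shift// m3 subrr mul0r add0r partialM//; last first.
  by apply: differentiableD => //; exact: differentiableM.
rewrite pu partialD//; last exact: differentiableM.
by rewrite pu2 partial_cst /u subrr; ring.
Qed.
End smoothing_smooth.

(** * Limits as the width of the Gaussian tends to zero *)

Section local_growth.
Context {R : realType} {d : nat}.
Implicit Types (phi : 'rV[R]_d -> R) (x : 'rV[R]_d).

(** The norm of a nonzero vector is the absolute value of one of its coordinates, so
    one summand equals the left-hand side. Sums of even powers are what the
    moments control. *)
Lemma norm_exprn_le_sum (w : 'rV[R]_d) k :
  `|w| ^+ k.+1.*2 <= \sum_j (w ord0 j) ^+ k.+1.*2.
Proof.
have ge0 (r : R) : 0 <= r ^+ k.+1.*2 by rewrite -mul2n exprM exprn_ge0// sqr_ge0.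
have [->|/norm_coord_eq[i ->]] := eqVneq w 0.
  by rewrite normr0 expr0n/= sumr_ge0.
rewrite (bigD1 i)//= -mul2n !exprM (real_normK (num_real _)) lerDl sumr_ge0//.
by move=> j _; rewrite exprM exprn_ge0// sqr_ge0.
Qed.

(** Outside a neighbourhood of [x] the bound [2 * B] is absorbed by the quadratic
    term, so that a second moment replaces the estimate of a Gaussian tail. *)
Lemma continuous_growth phi x B e : 0 < e -> (forall z, `|phi z| <= B) ->
  {for x, continuous phi} ->
  exists2 C, 0 <= C & forall z, `|phi z - phi x| <= e + C * `|z - x| ^+ 2.
Proof.
move=> e0 phiB cphi.
have B0 : 0 <= B by rewrite (le_trans _ (phiB x)).
have : \forall z \near x, `|phi z - phi x| <= e.
  by move/cvgrPdistC_le : cphi => /(_ _ e0).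
move=> /nbhs_normP[r /= r0 rP].
exists (2 * B / r ^+ 2); first by rewrite divr_ge0 ?sqr_ge0// mulr_ge0.
move=> z; have [zr|zr] := ltP `|z - x| r.
  apply: le_trans (rP z _) _; first by rewrite /ball_/= distrC.
  by rewrite lerDl mulr_ge0 ?sqr_ge0// divr_ge0 ?sqr_ge0// mulr_ge0.
apply: (@le_trans _ _ (2 * B)).
  by rewrite (le_trans (ler_normB _ _))// mulr2n mulrDl mul1r lerD.
apply: (@le_trans _ _ (2 * B / r ^+ 2 * `|z - x| ^+ 2)); last by rewrite lerDr ltW.
rewrite -mulrA ler_peMr ?mulr_ge0//.
by rewrite mulrC ler_pdivlMr ?exprn_gt0// mul1r lerXn2r ?nnegrE// ltW.
Qed.

Lemma diff_partial phi x h : differentiable phi x ->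
  'd phi x h = \sum_j partial j phi x * h ord0 j.
Proof.
move=> dphi; rewrite [in LHS](row_sum_delta h) linear_sum; apply: eq_bigr => j _.
by rewrite linearZ /= /partial deriveE// mulrC.
Qed.

(** The far field is at most [2 * B] plus a linear term. It is absorbed by a cubic
    rather than a quadratic term, so that after multiplication by a coordinate
    only even moments occur. *)
Lemma differentiable_growth phi x B e : 0 < e -> (forall z, `|phi z| <= B) ->
  differentiable phi x ->
  exists2 C, 0 <= C &
    forall z, `|phi z - (phi x + \sum_j partial j phi x * (z - x) ord0 j)| <=
      e * `|z - x| + C * `|z - x| ^+ 3.
Proof.
move=> e0 phiB dphi.
have B0 : 0 <= B by rewrite (le_trans _ (phiB x)).
pose L := \sum_j `|partial j phi x|.
have L0 : 0 <= L by rewrite sumr_ge0.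
have : \forall h \near (0 : 'rV[R]_d),
    `|phi (h + x) - (phi x + \sum_j partial j phi x * h ord0 j)| <= e * `|h|.
  have /eqaddoP/(_ _ e0) := diff_locally dphi.
  move=> H; apply: (filterS _ (H : nbhs (0 : 'rV[R]_d) _)) => h /=.
  by rewrite -diff_partial.
move=> /nbhs_normP[r /= r0 rP].
have C0 : 0 <= 2 * B / r ^+ 3 + L / r ^+ 2.
  by apply: addr_ge0; apply: divr_ge0; rewrite ?exprn_ge0 ?(ltW r0)// mulr_ge0.
exists (2 * B / r ^+ 3 + L / r ^+ 2) => // z; set w := z - x.
have n0 := normr_ge0 w.
have [zr|zr] := ltP `|w| r.
  have := rP w; rewrite /ball_/= sub0r normrN subrK => /(_ zr) H.
  by apply: le_trans H _; rewrite lerDl mulr_ge0// exprn_ge0.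
apply: (@le_trans _ _ ((2 * B / r ^+ 3 + L / r ^+ 2) * `|w| ^+ 3)); last first.
  by rewrite lerDr mulr_ge0// ltW.
rewrite opprD addrA (le_trans (ler_normB _ _))// mulrDl lerD//.
  apply: (@le_trans _ _ (2 * B)).
    by rewrite (le_trans (ler_normB _ _))// mulr2n mulrDl mul1r lerD.
  rewrite -mulrA ler_peMr ?mulr_ge0//.
  by rewrite mulrC ler_pdivlMr ?exprn_gt0// mul1r lerXn2r ?nnegrE// ltW.
apply: (@le_trans _ _ (L * `|w|)).
  rewrite mulr_suml; apply: le_trans (ler_norm_sum _ _ _) _.
  by apply: ler_sum => i _; rewrite normrM ler_wpM2l// coord_le_norm.
rewrite -mulrA ler_wpM2l// [`|w| ^+ 3]exprS mulrCA ler_peMr//.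
by rewrite mulrC ler_pdivlMr ?exprn_gt0// mul1r lerXn2r ?nnegrE// ltW.
Qed.
End local_growth.

Section limits.
Context {R : realType} {d : nat}.
Variables (phi : 'rV[R]_d -> R) (x : 'rV[R]_d) (B : R).
Hypothesis mphi : vmeasurable phi.
Hypothesis phiB : forall z, `|phi z| <= B.

Let tphi : tame phi. Proof. exact: tame_bounded mphi phiB. Qed.

Let tw k j : tame (fun z : 'rV[R]_d => (z ord0 j - x ord0 j) ^+ k).
Proof. by apply: tameX; apply: tameB; [exact: tame_coord|exact: tame_cst]. Qed.

Lemma smoothing_sum_sqr xi : 0 < xi ->
  smoothing xi (fun z : 'rV[R]_d => \sum_j (z ord0 j - x ord0 j) ^+ 2) x =
  d%:R * xi ^+ 2.
Proof.
move=> xi0; rewrite smoothing_sum//.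
rewrite (eq_bigr (fun=> xi ^+ 2)); first by rewrite sumr_const card_ord -[LHS]mulr_natl.
by move=> j _; rewrite smoothing_second_moment// subrr mul0r add0r eqxx mulr1.
Qed.

Lemma smoothing_sum_quartic xi : 0 < xi ->
  smoothing xi (fun z : 'rV[R]_d => \sum_j (z ord0 j - x ord0 j) ^+ 4) x =
  d%:R * (3 * xi ^+ 4).
Proof.
move=> xi0; rewrite smoothing_sum//.
rewrite (eq_bigr (fun=> 3 * xi ^+ 4)); first by rewrite sumr_const card_ord -[LHS]mulr_natl.
by move=> j _; rewrite smoothing_fourth_moment.
Qed.

Lemma near_right_sqr_le (C e : R) : 0 <= C -> 0 < e ->
  \forall xi \near 0^'+, 0 < xi /\ C * xi ^+ 2 <= e.
Proof.
move=> C0 e0.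
have C1 : 0 < C + 1 by rewrite ltr_wpDl.
have eC : 0 < Num.min 1 (e / (C + 1)) by rewrite lt_min ltr01 divr_gt0.
near=> xi.
have xi0 : 0 < xi by near: xi; exact: nbhs_right_gt.
have : xi < Num.min 1 (e / (C + 1)) by near: xi; exact: nbhs_right_lt.
rewrite lt_min ltr_pdivlMr// => /andP[xi1 xie]; split => //.
apply: le_trans (ltW xie); rewrite mulrC ler_pM ?sqr_ge0//.
  by rewrite expr2 ler_piMr// ltW.
by rewrite lerDl.
Unshelve. all: by end_near. Qed.

Lemma smoothing_cvg : {for x, continuous phi} ->
  smoothing xi phi x @[xi --> 0^'+] --> phi x.
Proof.
move=> cphi; apply/cvgrPdistC_le => e e0.
have e20 : 0 < e / 2 by rewrite divr_gt0.
have [C C0 CP] := continuous_growth e20 phiB cphi.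
have Cd : 0 <= C * d%:R by rewrite mulr_ge0.
apply: (filterS _ (near_right_sqr_le Cd e20)) => xi [xi0 xie].
rewrite -[X in _ - X](smoothing_cst xi0 (phi x) x) -smoothingB//; last exact: tame_cst.
apply: (@le_trans _ _ (smoothing xi
    (fun z => e / 2 + C * \sum_j (z ord0 j - x ord0 j) ^+ 2) x)).
  apply: le_norm_smoothing => //.
  - by apply: tameB => //; exact: tame_cst.
  - by apply: tameD; [exact: tame_cst|apply: tameZ; apply: tame_sum => j; exact: tw].
  move=> z; apply: le_trans (CP z) _; rewrite lerD2l ler_wpM2l//.
  apply: le_trans (norm_exprn_le_sum (z - x) 0) _.
  by apply: ler_sum => j _; rewrite !mxE.
rewrite smoothingD//; [|exact: tame_cst|by apply: tameZ; apply: tame_sum => j; exact: tw].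
rewrite smoothing_cst// smoothingZ//; last by apply: tame_sum => j; exact: tw.
rewrite smoothing_sum_sqr// [leRHS]splitr mulrA lerD2l//.
Qed.

(** The affine part of [phi] at [x] reproduces the derivative exactly: its constant
    term meets the vanishing first moments and its linear part meets the second
    moments [xi^2 * (i == j)]. *)
Lemma partial_smoothing_expand xi i : 0 < xi ->
  let r z := phi z - (phi x + \sum_j partial j phi x * (z - x) ord0 j) in
  partial i (smoothing xi phi) x - partial i phi x =
  xi ^- 2 * smoothing xi (fun z => (z ord0 i - x ord0 i) * r z) x.
Proof.
move=> xi0 r; have [_ ->] := smoothing_differentiable xi0 x tphi.
have t1 j : tame (fun z : 'rV[R]_d => z ord0 j - x ord0 j).
  by apply: tameB; [exact: tame_coord|exact: tame_cst].
have tS : tame (fun z => \sum_j partial j phi x * (z - x) ord0 j).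
  apply: tame_sum => j; apply: tameZ; under eq_fun do rewrite !mxE.
  exact: t1.
have tr : tame r by apply: tameB => //; apply: tameD => //; exact: tame_cst.
rewrite (_ : (fun z : 'rV[R]_d => (z ord0 i - x ord0 i) * phi z) = (fun z : 'rV[R]_d =>
   (phi x * (z ord0 i - x ord0 i) +
    \sum_j partial j phi x * ((z ord0 i - x ord0 i) * (z ord0 j - x ord0 j))) +
   (z ord0 i - x ord0 i) * r z)); last first.
  apply/funext => z; rewrite /r.
  rewrite (_ : \sum_j _ = (z ord0 i - x ord0 i) * \sum_j partial j phi x * (z - x) ord0 j).
    by ring.
  by rewrite mulr_sumr; apply: eq_bigr => j _; rewrite !mxE; ring.
have tS2 : tame (fun z : 'rV[R]_d => \sum_j partial j phi x *
    ((z ord0 i - x ord0 i) * (z ord0 j - x ord0 j))).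
  by apply: tame_sum => j; apply: tameZ; exact: tameM.
rewrite smoothingD//; [|by apply: tameD => //; exact: tameZ|exact: tameM].
rewrite smoothingD//; last exact: tameZ.
rewrite smoothingZ// smoothing_first_moment// subrr mulr0 add0r.
rewrite smoothing_sum//; last by move=> j; apply: tameZ; exact: tameM.
rewrite (bigD1 i)//= big1 => [|j ji].
  rewrite smoothingZ; [|by []|exact: tameM].
  rewrite smoothing_second_moment// subrr mul0r add0r eqxx mulr1 addr0.
  rewrite mulrDr [xi ^- 2 * (_ * _)]mulrCA mulVf ?gt_eqF ?exprn_gt0//.
  by rewrite mulr1 addrAC subrr add0r.
rewrite smoothingZ; [|by []|exact: tameM].
by rewrite smoothing_second_moment// subrr mul0r add0r eq_sym (negbTE ji) !mulr0.
Qed.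

(** With the growth constant [e / 2 / (d + 1)], the second moments contribute at most
    [e / 2] and the fourth moments [3 * C * d * xi^2], uniformly in the
    coordinate, which is what convergence in the sup norm asks for. *)
Lemma grad_smoothing_cvg : differentiable phi x ->
  grad (smoothing xi phi) x @[xi --> 0^'+] --> grad phi x.
Proof.
move=> dphi; apply/cvgrPdistC_le => e e0.
have d1 : 0 < d%:R + 1 :> R by rewrite ltr_wpDl.
have e20 : 0 < e / 2 by rewrite divr_gt0.
have ed0 : 0 < e / 2 / (d%:R + 1) by rewrite divr_gt0.
have [C C0 CP] := differentiable_growth ed0 phiB dphi.
have Cd : 0 <= C * (d%:R * 3) by rewrite !mulr_ge0.
apply: (filterS _ (near_right_sqr_le Cd e20)) => xi [xi0 xie].
apply: norm_le_coord => [|i]; first exact: ltW.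
rewrite !mxE partial_smoothing_expand//.
set r := (fun z => _).
have t1 j : tame (fun z : 'rV[R]_d => z ord0 j - x ord0 j).
  by apply: tameB; [exact: tame_coord|exact: tame_cst].
have tr : tame r.
  apply: tameM => //; apply: tameB => //; apply: tameD; first exact: tame_cst.
  apply: tame_sum => j; apply: tameZ; under eq_fun do rewrite !mxE.
  exact: t1.
have ts k : tame (fun z : 'rV[R]_d => \sum_j (z ord0 j - x ord0 j) ^+ k).
  by apply: tame_sum => j; exact: tw.
have H : `|smoothing xi r x| <= smoothing xi
    (fun z => e / 2 / (d%:R + 1) * (\sum_j (z ord0 j - x ord0 j) ^+ 2) +
              C * \sum_j (z ord0 j - x ord0 j) ^+ 4) x.
  apply: le_norm_smoothing => //; first by apply: tameD; exact: tameZ.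
  move=> z; rewrite /r normrM.
  apply: (@le_trans _ _ (`|z - x| * (e / 2 / (d%:R + 1) * `|z - x| + C * `|z - x| ^+ 3))).
    rewrite ler_pM//.
    by have := coord_le_norm (z - x) i; rewrite !mxE.
  rewrite mulrDr mulrCA -expr2 [`|_| * (C * _)]mulrCA -exprS.
  apply: lerD; rewrite ler_wpM2l ?(ltW ed0)//.
    apply: le_trans (norm_exprn_le_sum (z - x) 0) _.
    by apply: ler_sum => j _; rewrite !mxE.
  apply: le_trans (norm_exprn_le_sum (z - x) 1) _.
  by apply: ler_sum => j _; rewrite !mxE.
move: H; rewrite smoothingD//; try exact: tameZ.
rewrite !smoothingZ// smoothing_sum_sqr// smoothing_sum_quartic// => H.
have x20 : 0 < xi ^+ 2 by rewrite exprn_gt0.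
rewrite normrM ger0_norm ?invr_ge0 ?(ltW x20)// mulrC ler_pdivrMr//.
apply: le_trans H _.
have h1 : e / 2 / (d%:R + 1) * d%:R <= e / 2.
  by rewrite mulrAC ler_pdivrMr// ler_wpM2l ?(ltW e20)// lerDl.
have := ler_wpM2r (ltW x20) h1; have := ler_wpM2r (ltW x20) xie.
rewrite (_ : xi ^+ 4 = xi ^+ 2 * xi ^+ 2); last by rewrite -exprD.
move=> h2 h3.
have -> : e * xi ^+ 2 = e / 2 * xi ^+ 2 + e / 2 * xi ^+ 2 by rewrite -mulrDl -splitr.
apply: lerD; first by rewrite mulrA.
by apply: le_trans h2; rewrite le_eqVlt; apply/orP; left; apply/eqP; ring.
Qed.
End limits.

(** * Euclidean projection onto a compact convex set *)

Section projection.
Context {R : realType} {d : nat}.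
Variable X : set 'rV[R]_d.
Hypothesis X_convex : convex_set (X : set (convex_lmodType 'rV[R]_d)).
Hypothesis X_compact : compact X.

(** Nearest points are the same for the squared distance, which is polynomial. *)
Lemma enorm_le (u v : 'rV[R]_d) : (enorm u <= enorm v) = (sqn u <= sqn v).
Proof. by rewrite /enorm -!/(sqn _) ler_sqrt// sqn_ge0. Qed.

Lemma sqn_dist_continuous (v : 'rV[R]_d) : continuous (fun p : 'rV[R]_d => sqn (v - p)).
Proof.
apply: continuous_big => [|i _]; first exact: add_continuous.
move=> p; apply: (@continuous_comp _ _ _ (fun p : 'rV[R]_d => (v - p) ord0 i)
  (fun r : R => r ^+ 2)); last exact: exprn_continuous.
apply: (@continuous_comp _ _ _ (fun p : 'rV[R]_d => v - p)
  (fun w : 'rV[R]_d => w ord0 i)); last exact: coord_continuous.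
by apply: continuousB; [exact: cst_continuous|exact: cvg_id].
Qed.

Lemma euclidean_projP (v : 'rV[R]_d) : X !=set0 ->
  X (euclidean_proj X v) /\
  forall q, X q -> sqn (v - euclidean_proj X v) <= sqn (v - q).
Proof.
move=> X0.
have [|c] := EVT_min_rV X0 X_compact (f := fun p : 'rV[R]_d => sqn (v - p)).
  by apply: continuous_subspaceT => p; exact: sqn_dist_continuous.
rewrite inE => Xc cP.
have [Xp pP] : [set p | X p /\ forall q, X q -> enorm (v - p) <= enorm (v - q)]
    (euclidean_proj X v).
  by apply: (@getI _ _ c); split => // q Xq; rewrite enorm_le; apply: cP; rewrite inE.
by split=> // q Xq; rewrite -enorm_le; exact: pP.
Qed.

(** Moving from the nearest point [p] towards [q] by a small step [t] changes the
    squared distance by [- 2 * t * s + t^2 * |q - p|^2], where [s] is the sum in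
    the statement; this would be negative for small [t] if [s] were positive. *)
Lemma euclidean_proj_variational (v q : 'rV[R]_d) : X q ->
  \sum_i (v - euclidean_proj X v) ord0 i * (q - euclidean_proj X v) ord0 i <= 0.
Proof.
move=> Xq; have [|Xp pP] := euclidean_projP v; first by exists q.
set p := euclidean_proj X v in Xp pP *; set s := \sum_i _.
rewrite leNgt; apply/negP => s0.
have N0 := sqn_ge0 (q - p).
(* This step keeps [t <= 1] and makes [t * |q - p|^2 <= s]. *)
pose t := Num.min 1 (s / (sqn (q - p) + 1)).
have N1 : 0 < sqn (q - p) + 1 by rewrite ltr_wpDl.
have t0 : 0 < t by rewrite lt_min ltr01 divr_gt0.
have t1 : t <= 1 by rewrite ge_min lexx.
have ts : t * (sqn (q - p) + 1) <= s by rewrite -ler_pdivlMr// ge_min lexx orbT.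
have Xt : X (t *: q + (1 - t) *: p).
  have := @X_convex q p (Itv01 (ltW t0) t1); rewrite !inE => H.
  exact: H.
have := pP _ Xt.
have -> : v - (t *: q + (1 - t) *: p) = (v - p) - t *: (q - p).
  by apply/rowP => i; rewrite !mxE; ring.
have -> : sqn ((v - p) - t *: (q - p)) = sqn (v - p) - 2 * t * s + t ^+ 2 * sqn (q - p).
  rewrite /sqn /s !mulr_sumr -sumrN -!big_split/=.
  by apply: eq_bigr => i _; rewrite !mxE; ring.
have : t * (t * (sqn (q - p) + 1)) <= t * s by rewrite ler_wpM2l// ltW.
have : 0 < t * s by rewrite mulr_gt0.
have : 0 <= t ^+ 2 by rewrite sqr_ge0.
nra.
Qed.

(** Adding the two variational inequalities gives [|p - q|^2 <= <u - v, p - q>], and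
    the product is at most the mean of the two squares. If [X] is empty, the
    projection is a constant. *)
Lemma euclidean_proj_nonexpansive (u v : 'rV[R]_d) :
  sqn (euclidean_proj X u - euclidean_proj X v) <= sqn (u - v).
Proof.
have [->|/set0P X0] := eqVneq X set0.
  rewrite /euclidean_proj !getPN; [|by move=> x []|by move=> x []].
  by rewrite subrr /sqn big1 ?sqn_ge0// => i _; rewrite mxE expr0n.
have [Xp _] := euclidean_projP u X0; have [Xq _] := euclidean_projP v X0.
have := euclidean_proj_variational u Xq; have := euclidean_proj_variational v Xp.
set p := euclidean_proj X u; set q := euclidean_proj X v => h1 h2.
have h : sqn (p - q) <= \sum_i (u - v) ord0 i * (p - q) ord0 i.
  rewrite -subr_ge0; have := lerD h1 h2; rewrite addr0 -big_split/= -oppr_ge0.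
  congr (0 <= _); rewrite /sqn -!sumrN -big_split/=.
  by apply: eq_bigr => i _; rewrite !mxE; ring.
have : \sum_i (u - v) ord0 i * (p - q) ord0 i <= (sqn (u - v) + sqn (p - q)) / 2.
  rewrite /sqn -big_split/= mulr_suml; apply: ler_sum => i _.
  have := sqr_ge0 ((u - v) ord0 i - (p - q) ord0 i); nra.
lra.
Qed.

Lemma cvg_euclidean_proj (T : Type) (F : set_system T) (FF : Filter F)
    (u : T -> 'rV[R]_d) v :
  u @ F --> v -> euclidean_proj X (u t) @[t --> F] --> euclidean_proj X v.
Proof.
move=> /cvgrPdist_le uv; apply/cvgrPdist_le => e e0.
have d1 : 0 < d%:R + 1 :> R by rewrite ltr_wpDl.
have ed : 0 < e / (d%:R + 1) by rewrite divr_gt0.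
apply: (filterS _ (uv _ ed)) => t; rewrite ler_pdivlMr// => {}uv.
apply: norm_le_coord => [|i]; first exact: ltW.
rewrite -ler_sqr ?nnegrE ?(ltW e0)// (real_normK (num_real _)).
apply: le_trans (sqn_coord _ i) _.
apply: le_trans (euclidean_proj_nonexpansive _ _) _.
apply: (@le_trans _ _ ((`|v - u t| * (d%:R + 1)) ^+ 2)); last first.
  by rewrite lerXn2r ?nnegrE ?mulr_ge0// ?ltW.
apply: (@le_trans _ _ (`|v - u t| ^+ 2 * d%:R)).
  rewrite -[d in d%:R]card_ord mulr_natr -sumr_const; apply: ler_sum => j _.
  by rewrite -(real_normK (num_real _)) lerXn2r ?nnegrE ?coord_le_norm.
rewrite exprMn ler_wpM2l ?sqr_ge0//.
have : 0 <= d%:R :> R by []. nra.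
Qed.
End projection.

(** * The correspondence-driven hyperfunction *)

Section hyperfunction.
Context {R : realType} {n m : nat}.
Variables (X : set 'rV[R]_n) (f g : 'rV[R]_n -> 'rV[R]_m -> R).
Variables (y0 : 'rV[R]_m) (M : method R m) (eta : nat -> R) (fbar : R).
Variable ycd : 'rV[R]_n -> 'rV[R]_m.

(** The tail of the iterates lies in the sublevel set, which is compact and hence
    closed. *)
Lemma Shat_sublevel K0 x y :
  compact (sublevel g y0 x) ->
  (forall k, (K0 <= k)%N -> sublevel g y0 x (iterates M eta g y0 x k)) ->
  Shat M eta g y0 x y -> sublevel g y0 x y.
Proof.
move=> cS itS Sy.
have clS : closed (sublevel g y0 x).
  by apply: compact_closed cS; exact: norm_hausdorff.
apply: clS => B nB; apply: Sy => //.
by exists K0 => // k /= K0k; exact: itS.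
Qed.

Lemma cvg_row_mx (T : Type) (F : set_system T) (FF : Filter F)
    (u : T -> 'rV[R]_n) (v : T -> 'rV[R]_m)
    (a : 'rV[R]_n) (b : 'rV[R]_m) :
  u @ F --> a -> v @ F --> b -> row_mx (u t) (v t) @[t --> F] --> row_mx a b.
Proof.
move=> /cvgrPdist_le ua /cvgrPdist_le vb; apply/cvgrPdist_le => e e0.
apply: (filterS _ (filterI (ua e e0) (vb e e0))) => t [uat vbt].
apply: norm_le_coord => [|i]; first exact: ltW.
rewrite !mxE; case: splitP => j _.
  by have := le_trans (coord_le_norm _ j) uat; rewrite !mxE.
by have := le_trans (coord_le_norm _ j) vbt; rewrite !mxE.
Qed.

(** The map [z |-> (z, ycd z)] takes values in the cylinder over [X], so that
    the continuity of [f] relative to this cylinder applies. *)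
Lemma phi_cd_continuous_within x :
  {within cylinder X, continuous (joint f)} -> X x ->
  ycd @ within X (nbhs x) --> ycd x ->
  phi_cd X f ycd fbar @ within X (nbhs x) --> phi_cd X f ycd fbar x.
Proof.
move=> /subspace_continuousP fc Xx yc.
pose h z := row_mx z (ycd z).
have hE z : joint f (h z) = f z (ycd z) by rewrite /joint /h row_mxKl row_mxKr.
have hc : h @ within X (nbhs x) --> within (cylinder X) (nbhs (h x)).
  move=> A /= hA.
  have hc : h @ within X (nbhs x) --> h x.
    by apply: cvg_row_mx => //; exact: cvg_within.
  have := hc _ hA; rewrite /= => H.
  have H' : nbhs x (fun z => X z -> cylinder X (h z) -> A (h z)) := H.
  apply: (filterS _ H') => z Hz Xz; apply: Hz => //.
  by rewrite /cylinder /= /h row_mxKl.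
have Xhx : cylinder X (h x) by rewrite /cylinder /= /h row_mxKl.
have : joint f (h z) @[z --> within X (nbhs x)] --> joint f (h x).
  exact: (@cvg_comp _ _ _ h (joint f) _ _ _ hc (fc _ Xhx)).
rewrite hE {2}/phi_cd mem_set//; apply: cvg_trans.
by apply: fmap_within_eq => z Xz; rewrite /= hE /phi_cd Xz.
Qed.

Lemma phi_cd_bounded : (forall x, X x -> sublevel g y0 x (ycd x)) ->
  (forall x y, X x -> sublevel g y0 x y -> `|f x y| <= fbar) ->
  forall x, `|phi_cd X f ycd fbar x| <= `|fbar|.
Proof.
move=> yS fb x; rewrite /phi_cd; case: ifPn => // /set_mem Xx.
by rewrite (le_trans (fb _ _ Xx (yS _ Xx)))// ler_norm.
Qed.
End hyperfunction.

Theorem proposition3p2 (R : realType) (n m : nat)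
  (X : set 'rV[R]_n) (f g : 'rV[R]_n -> 'rV[R]_m -> R) (y0 : 'rV[R]_m)
  (Lg LLg Lf glow fbar : R) (Y : set 'rV[R]_m)
  (M : method R m) (eta : nat -> R) (K0 : nat) (ycd : 'rV[R]_n -> 'rV[R]_m)
  (* regularity of the data *)
  (f_continuous : {within cylinder X, continuous (joint f)})
  (g_C2 : exists U, [/\ open U, cylinder X `<=` U & Ck_on 2 U (joint g)])
  (X_convex : convex_set (X : set (convex_lmodType 'rV[R]_n)))
  (X_compact : compact X)
  (g_smooth : lipschitz_wrt enorm Lg (cylinder X) (grad (joint g)))
  (g_hessian : lipschitz_wrt opnorm LLg (cylinder X)
     (joint (fun x => hessian (g x))))
  (g_lower : forall x y, X x -> glow <= g x y)
  (Y_compact : compact Y)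
  (sublevel_compact : forall x, X x ->
     compact (sublevel g y0 x) /\ sublevel g y0 x `<=` Y)
  (f_lipschitz : lipschitz_wrt (fun r : R => `|r|) Lf
     [set w | X (lsubmx w) /\ sublevel g y0 (lsubmx w) (rsubmx w)] (joint f))
  (f_bounded : forall x y, X x -> sublevel g y0 x y -> `|f x y| <= fbar)
  (* lower-level method *)
  (iter0 : forall x, X x -> iterates M eta g y0 x 0%N = y0)
  (Shat_stationary : forall x y, X x -> Shat M eta g y0 x y ->
     stationary (g x) y)
  (iter_sublevel : forall x k, X x -> (K0 <= k)%N ->
     sublevel g y0 x (iterates M eta g y0 x k))
  (ycd_argmin : forall x, X x ->
     Shat M eta g y0 x (ycd x) /\
     (forall y, Shat M eta g y0 x y -> f x (ycd x) <= f x y))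
  (* null sets *)
  (non_morse_null : lebesgue_null (non_morse X g))
  (ycd_discontinuity_null : lebesgue_null
     [set x | [/\ X x, ~ non_morse X g x
                & ~ (ycd @ within X (nbhs x) --> ycd x)]]) :
  (forall xi : R, 0 < xi -> smooth (smoothing xi (phi_cd X f ycd fbar))) /\
  (forall xbar : 'rV[R]_n,
     ({for xbar, continuous (phi_cd X f ycd fbar)} ->
        smoothing xi (phi_cd X f ycd fbar) xbar @[xi --> 0^'+]
          --> phi_cd X f ycd fbar xbar) /\
     (differentiable (phi_cd X f ycd fbar) xbar ->
        (grad (smoothing xi (phi_cd X f ycd fbar)) xbar @[xi --> 0^'+]
           --> grad (phi_cd X f ycd fbar) xbar) /\
        (forall beta : R, 0 < beta ->
           beta^-1 *: (xbar - euclidean_proj X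
             (xbar - beta *: grad (smoothing xi (phi_cd X f ycd fbar)) xbar))
             @[xi --> 0^'+]
           --> beta^-1 *: (xbar - euclidean_proj X
             (xbar - beta *: grad (phi_cd X f ycd fbar) xbar))))).
Proof.
set phi := phi_cd X f ycd fbar.
have ycd_sublevel x : X x -> sublevel g y0 x (ycd x).
  move=> Xx; apply: (@Shat_sublevel _ _ _ _ _ M eta K0).
  - exact: (sublevel_compact _ Xx).1.
  - by move=> k; exact: iter_sublevel.
  - exact: (ycd_argmin _ Xx).1.
have phiB := phi_cd_bounded ycd_sublevel f_bounded.
have X_closed : closed X by apply: compact_closed X_compact; exact: norm_hausdorff.
have mphi : vmeasurable phi.
  apply: (@ae_continuous_vmeasurable _ _ X (non_morse X g `|` [set x |
    [/\ X x, ~ non_morse X g x & ~ (ycd @ within X (nbhs x) --> ycd x)]]) fbar) => //.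
  - exact: negligibleU.
  - move=> x Xx nN; apply: phi_cd_continuous_within => //.
    apply: contrapT => nc; apply: (nN); right.
    by split => // nm; apply: nN; left.
  - by move=> x nXx; rewrite /phi /phi_cd memNset.
have tphi : tame phi := tame_bounded mphi phiB.
split=> [xi xi0|xbar]; first exact: smoothing_smooth.
split=> [cphi|dphi]; first exact: smoothing_cvg.
have gphi := grad_smoothing_cvg mphi phiB dphi.
split=> // beta beta0.
apply: cvgZl_tmp; apply: cvgB; first exact: cvg_cst.
apply: cvg_euclidean_proj => //.
by apply: cvgB; [exact: cvg_cst|apply: cvgZl_tmp; exact: gphi].
Qed.
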